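(* For all $z\in\mathbb{C}\setminus\{0\}$ with $|\arg z|<\pi$, the derivative of $W$ satisfies $$W'(z)=\frac{1}{\pi}\int_0^\pi\frac{dv}{z+v\csc(v)\,e^{-v\cot v}} .$$
   Context: $W$ denotes the principal branch of the Lambert $W$ function: the unique holomorphic function on $\mathbb{C}\setminus(-\infty,-1/e]$ with $W(z)e^{W(z)}=z$ and $W(0)=0$. $|\arg z|<\pi$ means $z\in\mathbb{C}\setminus(-\infty,0]$. *)

(* Defs.v *)
From Stdlib Require Import Reals.
From Coquelicot Require Import Coquelicot.
Local Open Scope R_scope.

Definition Cexp (z : C) : C :=
  (exp (Re z) * cos (Im z), exp (Re z) * sin (Im z)).

(* The complex plane cut along the real half-line (-oo, a].  For a = 0 this is
   the set of nonzero z with |arg z| < PI, arg being the principal argument. *)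
Definition cut_plane (a : R) (z : C) : Prop :=
  ~ (Im z = 0 /\ Re z <= a).

(* Holomorphy on a set (meant for open sets): complex differentiability at each
   point, C being a normed module over itself. *)
Definition holomorphic_on (D : C -> Prop) (f : C -> C) : Prop :=
  forall z : C, D z -> @ex_derive C_AbsRing C_NormedModule f z.

(* W is the principal branch of the Lambert function.  These conditions determine
   W on the cut plane; its values on the cut are left arbitrary. *)
Definition is_LambertW (W : C -> C) : Prop :=
  holomorphic_on (cut_plane (- / exp 1)) W /\
  (forall z : C, cut_plane (- / exp 1) z -> (W z * Cexp (W z))%C = z) /\
  W (RtoC 0) = RtoC 0.

Definition csc (v : R) : R := / sin v.
Definition cot (v : R) : R := cos v / sin v.

(* The formula is meant for 0 < v < PI.  The junk values at 0 and PI, where sin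
   vanishes, affect neither the existence nor the value of the integral. *)
Definition dW_integrand (z : C) (v : R) : C :=
  (/ (z + RtoC (v * csc v * exp (- v * cot v))))%C.

(* Main.v *)
Require Import Defs.
From Stdlib Require Import Reals Lra.
From Coquelicot Require Import Coquelicot.
Local Open Scope R_scope.

(** Write E(u) = u e^u and w = W(z), so that E(w) = z and, by the chain rule,
    W'(z) = 1 / E'(w).  The formula is Cauchy's theorem for 1 / (E(u) - z) on the
    boundary of the range of W.

    That range is Omega, bounded by the curve u(v) = -v cot v + i v,
    -PI < v < PI, which E folds onto the cut:
    E(u(v)) = -t(v), with t(v) = v csc v e^(-v cot v).  The function t is even and
    the real part of u is even, so that on the two halves of the curve the real
    parts of du cancel and the imaginary parts add up: the integral of
    du / (E(u) - z) over the curve is 2 i times the integral of dv / (z + t(v))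
    over (0, PI).  Inside Omega the only pole is w, with residue 1 / E'(w), whence
    2 i (integral) = 2 i PI W'(z).

    Three things carry this.
    - The pole is alone, and lies inside.  [zexp_inj_Omega] shows that E takes the
      value z only once on Omega, and [Lambert_Omega] that w is in Omega: along the
      segment from 0 to z (not real), W starts on the side of z and, by the values of E,
      can cross neither the real axis nor the lines |Im u| = PI.
    - Cauchy's theorem, in the form needed here.  Omega is convex ([Omega_convex]),
      so a closed contour p in it can be contracted radially to w.  With
      h(u) = (u - w) / (E(u) - z), continued by h(w) = 1 / E'(w), the integral of
      h(w + r (p - w)) dp / (p - w) has an r-derivative whose integrand is a
      v-derivative ([star_piece]), so it does not depend on r.  At r = 1 it is the
      Cauchy integral, at r = 0 it is h(w) times the integral of dp / (p - w)
      ([contour_deform]), which is 2 i PI by an explicit angle function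
      ([contour_winding]).
    - The closing of the contour.  The curve is unbounded and u(v) is an undefined
      quotient at v = 0, so it is kept to e <= |v| <= V and closed by two vertical
      segments.  The left one has length 2 e and E - z is bounded away from 0 on it;
      on the right one |E| is at least -V cot V.  Both contributions vanish as e
      tends to 0 and V to PI ([integral_value]).

    On (0, PI) the integrand has a continuous extension to [0, PI], because 1 / t does
    ([inv_weight_cont]). *)

(** * Calculus of complex-valued functions *)

(** Continuity is stated on the components so that the rules reduce to those of
    real functions; [Ccont_continuous] links it to the topology of the plane. *)
Definition Ccont {T : UniformSpace} (f : T -> C) (x : T) : Prop :=
  continuous (fun t => Re (f t)) x /\ continuous (fun t => Im (f t)) x.

(** Derivative of a complex-valued function of a real variable, by components.
    Holomorphy enters the proof through chain rules along such real paths. *)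
Definition Cder (f : R -> C) (t : R) (l : C) : Prop :=
  is_derive (fun s => Re (f s)) t (Re l) /\ is_derive (fun s => Im (f s)) t (Im l).

Definition CInt (f : R -> C) (a b : R) : C :=
  (RInt (fun t => Re (f t)) a b, RInt (fun t => Im (f t)) a b).

Lemma Rcont_mult {T : UniformSpace} (f g : T -> R) x :
  continuous f x -> continuous g x -> continuous (fun t => f t * g t) x.
Proof. exact (continuous_mult (K := R_AbsRing) f g x). Qed.

Lemma Rcont_plus {T : UniformSpace} (f g : T -> R) x :
  continuous f x -> continuous g x -> continuous (fun t => f t + g t) x.
Proof. exact (continuous_plus (V := R_NormedModule) f g x). Qed.

Lemma Rcont_opp {T : UniformSpace} (f : T -> R) x :
  continuous f x -> continuous (fun t => - f t) x.
Proof. exact (continuous_opp (V := R_NormedModule) f x). Qed.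

Lemma Rcont_inv {T : UniformSpace} (f : T -> R) x :
  continuous f x -> f x <> 0 -> continuous (fun t => / f t) x.
Proof.
  intros Hf H0.
  exact (continuous_comp f Rinv x Hf (continuous_Rinv (f x) H0)).
Qed.

Lemma Ccont_const {T : UniformSpace} (c : C) (x : T) : Ccont (fun _ => c) x.
Proof. split; apply continuous_const. Qed.

Lemma Ccont_RtoC {T : UniformSpace} (f : T -> R) x :
  continuous f x -> Ccont (fun t => RtoC (f t)) x.
Proof. intros H; split; simpl; [exact H | apply continuous_const]. Qed.

Lemma Ccont_plus {T : UniformSpace} (f g : T -> C) x :
  Ccont f x -> Ccont g x -> Ccont (fun t => f t + g t)%C x.
Proof. intros [H1 H2] [H3 H4]; split; apply Rcont_plus; assumption. Qed.

Lemma Ccont_opp {T : UniformSpace} (f : T -> C) x :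
  Ccont f x -> Ccont (fun t => - f t)%C x.
Proof. intros [H1 H2]; split; apply Rcont_opp; assumption. Qed.

Lemma Ccont_minus {T : UniformSpace} (f g : T -> C) x :
  Ccont f x -> Ccont g x -> Ccont (fun t => f t - g t)%C x.
Proof. intros H1 H2; apply Ccont_plus; [|apply Ccont_opp]; assumption. Qed.

Lemma Ccont_mult {T : UniformSpace} (f g : T -> C) x :
  Ccont f x -> Ccont g x -> Ccont (fun t => f t * g t)%C x.
Proof.
  intros [H1 H2] [H3 H4]; split; unfold Re, Im in *; simpl.
  - apply Rcont_plus; [|apply Rcont_opp]; apply Rcont_mult; assumption.
  - apply Rcont_plus; apply Rcont_mult; assumption.
Qed.

Lemma C_sqnorm_neq0 (u : C) : u <> 0%C -> fst u ^ 2 + snd u ^ 2 <> 0.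
Proof.
  intros Hu H; apply Hu; destruct u as [a b]; simpl in *.
  assert (a = 0) by nra; assert (b = 0) by nra; subst; reflexivity.
Qed.

Lemma Ccont_inv {T : UniformSpace} (f : T -> C) x :
  Ccont f x -> f x <> 0%C -> Ccont (fun t => / f t)%C x.
Proof.
  intros [H1 H2] H0; apply C_sqnorm_neq0 in H0.
  assert (K : continuous (fun t => / (fst (f t) ^ 2 + snd (f t) ^ 2)) x).
  { apply Rcont_inv; [|exact H0].
    apply Rcont_plus; simpl; repeat apply Rcont_mult; try assumption;
      apply continuous_const. }
  split; unfold Re, Im in *; simpl; unfold Rdiv; apply Rcont_mult; try exact K.
  - exact H1.
  - apply Rcont_opp; exact H2.
Qed.

Lemma Ccont_div {T : UniformSpace} (f g : T -> C) x :
  Ccont f x -> Ccont g x -> g x <> 0%C -> Ccont (fun t => f t / g t)%C x.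
Proof. intros; apply Ccont_mult; [|apply Ccont_inv]; assumption. Qed.

Lemma Ccont_exp {T : UniformSpace} (f : T -> C) x :
  Ccont f x -> Ccont (fun t => Cexp (f t)) x.
Proof.
  intros [H1 H2]; split; simpl; apply Rcont_mult.
  1, 3: exact (continuous_comp _ exp x H1 (continuous_exp _)).
  - exact (continuous_comp _ cos x H2 (continuous_cos _)).
  - exact (continuous_comp _ sin x H2 (continuous_sin _)).
Qed.

Lemma Ccont_continuous {T : UniformSpace} (f : T -> C) x :
  Ccont f x <-> continuous (f : T -> C_UniformSpace) x.
Proof.
  split.
  - intros [H1 H2] P [e HP].
    generalize (H1 _ (locally_ball _ e)) (H2 _ (locally_ball _ e)).
    intros K1 K2. unfold filtermap in *.
    generalize (filter_and _ _ K1 K2). apply filter_imp.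
    intros t [A B]; apply HP; split; assumption.
  - intros H; split.
    + apply (continuous_comp f (fun c : C_UniformSpace => fst c) x H).
      apply continuous_fst.
    + apply (continuous_comp f (fun c : C_UniformSpace => snd c) x H).
      apply continuous_snd.
Qed.

Lemma Ccont_comp {T : UniformSpace} (q : T -> C) (f : C -> C) x :
  Ccont q x -> Ccont (T := C_UniformSpace) f (q x) -> Ccont (fun t => f (q t)) x.
Proof.
  rewrite !Ccont_continuous. intros Hq Hf. exact (continuous_comp q f x Hq Hf).
Qed.

Lemma Ccont_id (x : C) : Ccont (T := C_UniformSpace) (fun u => u) x.
Proof. apply Ccont_continuous; apply continuous_id. Qed.

Lemma Ccont_ext_loc {T : UniformSpace} (f g : T -> C) x :
  locally x (fun t => f t = g t) -> Ccont f x -> Ccont g x.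
Proof.
  intros H [H1 H2]; split.
  - apply (continuous_ext_loc _ (fun t => Re (f t))); [|exact H1].
    revert H; apply filter_imp; intros t ->; reflexivity.
  - apply (continuous_ext_loc _ (fun t => Im (f t))); [|exact H2].
    revert H; apply filter_imp; intros t ->; reflexivity.
Qed.

Lemma im_le_Cmod (u : C) : Rabs (Im u) <= Cmod u.
Proof. eapply Rle_trans; [apply Rmax_r | apply Rmax_Cmod]. Qed.

Lemma Ccont_eps {T : UniformSpace} (f : T -> C) x :
  (forall e : posreal, locally x (fun t => Cmod (f t - f x) <= e)) -> Ccont f x.
Proof.
  intros H; split; intros P [e HP];
    destruct (H (mkposreal (e / 2) ltac:(destruct e; simpl; lra))) as [d Hd];
    exists d; intros t Ht; apply HP; specialize (Hd t Ht); simpl in Hd;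
    destruct e as [e He]; simpl in *.
  - pose proof (re_le_Cmod (f t - f x)) as K.
    change (Rabs (Re (f t - f x)) < e). lra.
  - pose proof (im_le_Cmod (f t - f x)) as K.
    change (Rabs (Im (f t - f x)) < e). lra.
Qed.

Lemma Cmod_le_sum (u : C) : Cmod u <= Rabs (Re u) + Rabs (Im u).
Proof.
  pose proof (Rabs_pos (Re u)); pose proof (Rabs_pos (Im u)).
  unfold Cmod. apply Rsqr_incr_0; [|apply sqrt_pos|lra].
  rewrite Rsqr_sqrt by (apply Rplus_le_le_0_compat; apply pow2_ge_0).
  unfold Rsqr. pose proof (Rsqr_abs (Re u)); pose proof (Rsqr_abs (Im u)).
  unfold Rsqr, Re, Im in *. nra.
Qed.

Lemma Ccont_near {T : UniformSpace} (f : T -> C) x :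
  Ccont f x -> forall e : posreal, locally x (fun t => Cmod (f t - f x) <= e).
Proof.
  intros [H1 H2] e.
  assert (e2 : 0 < e / 2) by (destruct e; simpl; lra).
  generalize (H1 _ (locally_ball _ (mkposreal _ e2)))
    (H2 _ (locally_ball _ (mkposreal _ e2))).
  intros K1 K2. unfold filtermap in *.
  generalize (filter_and _ _ K1 K2). apply filter_imp.
  intros t [A B]. change (Rabs (Re (f t) - Re (f x)) < e / 2) in A.
  change (Rabs (Im (f t) - Im (f x)) < e / 2) in B.
  eapply Rle_trans; [apply Cmod_le_sum|].
  change (Rabs (Re (f t) - Re (f x)) + Rabs (Im (f t) - Im (f x)) <= e). lra.
Qed.

Lemma Cder_eq f t l l' : Cder f t l -> l = l' -> Cder f t l'.
Proof. intros H <-; exact H. Qed.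

Lemma Cder_const c t : Cder (fun _ => c) t 0%C.
Proof. split; simpl; apply (is_derive_const (V := R_NormedModule)). Qed.

Lemma Cder_RtoC f t l : is_derive f t l -> Cder (fun s => RtoC (f s)) t (RtoC l).
Proof. intros H; split; simpl; [exact H | apply (is_derive_const (V := R_NormedModule))]. Qed.

Lemma Rder_mult (f g : R -> R) t l m : is_derive f t l -> is_derive g t m ->
  is_derive (fun s => f s * g s) t (l * g t + f t * m).
Proof. intros; apply (is_derive_mult f g t l m); auto. intros; apply Rmult_comm. Qed.

Lemma Cder_plus f g t l m : Cder f t l -> Cder g t m ->
  Cder (fun s => f s + g s)%C t (l + m)%C.
Proof. intros [H1 H2] [H3 H4]; split; apply (is_derive_plus (V := R_NormedModule)); assumption. Qed.

Lemma Cder_opp f t l : Cder f t l -> Cder (fun s => - f s)%C t (- l)%C.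
Proof. intros [H1 H2]; split; apply (is_derive_opp (V := R_NormedModule)); assumption. Qed.

Lemma Cder_minus f g t l m : Cder f t l -> Cder g t m ->
  Cder (fun s => f s - g s)%C t (l - m)%C.
Proof. intros; apply Cder_plus; [|apply Cder_opp]; assumption. Qed.

Lemma Cder_mult f g t l m : Cder f t l -> Cder g t m ->
  Cder (fun s => f s * g s)%C t (l * g t + f t * m)%C.
Proof.
  intros [H1 H2] [H3 H4]; split; unfold Re, Im in *; simpl.
  - evar_last; [apply (is_derive_minus (V := R_NormedModule)); apply Rder_mult; eassumption|].
    unfold minus, plus, opp; simpl; ring.
  - evar_last; [apply (is_derive_plus (V := R_NormedModule)); apply Rder_mult; eassumption|].
    unfold minus, plus, opp; simpl; ring.
Qed.

Lemma Cder_inv f t l : Cder f t l -> f t <> 0%C ->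
  Cder (fun s => / f s)%C t (- l / (f t * f t))%C.
Proof.
  intros [H1 H2] H0; apply C_sqnorm_neq0 in H0; unfold Re, Im in *.
  assert (K : is_derive (fun s => / (fst (f s) ^ 2 + snd (f s) ^ 2)) t
    (- (2 * fst l * fst (f t) + 2 * snd l * snd (f t)) / (fst (f t) ^ 2 + snd (f t) ^ 2) ^ 2)).
  { evar_last.
    - apply is_derive_inv; [|exact H0].
      apply (is_derive_plus (V := R_NormedModule)); apply is_derive_pow; eassumption.
    - unfold plus; simpl; field. simpl in H0; lra. }
  assert (H5 : (fst (f t) * fst (f t) - snd (f t) * snd (f t)) ^ 2 +
     (fst (f t) * snd (f t) + snd (f t) * fst (f t)) ^ 2 <> 0).
  { replace (_ + _) with ((fst (f t) ^ 2 + snd (f t) ^ 2) ^ 2) by ring.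
    apply pow_nonzero; exact H0. }
  split; unfold Re, Im; simpl.
  - evar_last; [apply Rder_mult; [exact H1 | exact K]|].
    simpl; field.
    split; first [exact H5 | exact H0 | contradict H0; rewrite <- H0; ring
      | contradict H5; rewrite <- H5; ring].
  - evar_last; [apply Rder_mult; [apply (is_derive_opp (V := R_NormedModule)); exact H2 | exact K]|].
    unfold opp; simpl; field.
    split; first [exact H5 | exact H0 | contradict H0; rewrite <- H0; ring
      | contradict H5; rewrite <- H5; ring].
Qed.

Lemma Cder_div f g t l m : Cder f t l -> Cder g t m -> g t <> 0%C ->
  Cder (fun s => f s / g s)%C t ((l * g t - f t * m) / (g t * g t))%C.
Proof.
  intros Hf Hg H0. eapply Cder_eq.
  - apply Cder_mult; [exact Hf | apply Cder_inv; [exact Hg | exact H0]].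
  - simpl; field; exact H0.
Qed.

Lemma Cder_exp f t l : Cder f t l -> Cder (fun s => Cexp (f s)) t (l * Cexp (f t))%C.
Proof.
  intros [H1 H2].
  assert (K : is_derive (fun s => exp (Re (f s))) t (Re l * exp (Re (f t)))).
  { apply (is_derive_comp exp (fun s => Re (f s))); [apply is_derive_exp | exact H1]. }
  split; simpl.
  - evar_last.
    + apply Rder_mult; [exact K|].
      apply (is_derive_comp cos (fun s => Im (f s))); [apply is_derive_cos | exact H2].
    + unfold scal; simpl; unfold mult, Re, Im; simpl; ring.
  - evar_last.
    + apply Rder_mult; [exact K|].
      apply (is_derive_comp sin (fun s => Im (f s))); [apply is_derive_sin | exact H2].
    + unfold scal; simpl; unfold mult, Re, Im; simpl; ring.
Qed.

Lemma Cder_ext_loc f g t l : locally t (fun s => f s = g s) -> Cder f t l -> Cder g t l.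
Proof.
  intros H [H1 H2]; split.
  - apply (is_derive_ext_loc (fun s => Re (f s))); [|exact H1].
    revert H; apply filter_imp; intros s ->; reflexivity.
  - apply (is_derive_ext_loc (fun s => Im (f s))); [|exact H2].
    revert H; apply filter_imp; intros s ->; reflexivity.
Qed.

Lemma Cder_unique f t l m : Cder f t l -> Cder f t m -> l = m.
Proof.
  intros [H1 H2] [H3 H4]. apply is_derive_unique in H1, H2, H3, H4.
  apply injective_projections; unfold Re, Im in *; congruence.
Qed.

Lemma Cder_cont f t l : Cder f t l -> Ccont f t.
Proof.
  intros [H1 H2]; split;
    apply (ex_derive_continuous (V := R_NormedModule)); eexists; eassumption.
Qed.

(** * Radial deformation of contour integrals *)

(** The regularity that survives at the ends of a deformation over [0, 1]: the
    derivative is known in the interior only, and the uniform continuity, which looks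
    at parameters in [0, 1] alone, replaces continuity at the ends. *)
Definition unif_diff01 (f df : R -> R) : Prop :=
  (forall r, 0 < r < 1 -> is_derive f r (df r)) /\
  (forall e : posreal, exists d : posreal, forall r s,
     0 <= r <= 1 -> 0 <= s <= 1 -> Rabs (s - r) < d -> Rabs (f s - f r) <= e).

Lemma unif_diff01_plus f df g dg : unif_diff01 f df -> unif_diff01 g dg ->
  unif_diff01 (fun r => f r + g r) (fun r => df r + dg r).
Proof.
  intros [H1 H2] [H3 H4]; split.
  - intros r Hr; apply (is_derive_plus (V := R_NormedModule)); auto.
  - intros e. assert (e2 : 0 < e / 2) by (destruct e; simpl; lra).
    destruct (H2 (mkposreal _ e2)) as [d1 K1], (H4 (mkposreal _ e2)) as [d2 K2].
    assert (Hd : 0 < Rmin d1 d2) by (apply Rmin_pos; [destruct d1 | destruct d2]; auto).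
    exists (mkposreal _ Hd). simpl in *. intros r s Hr Hs Hrs.
    specialize (K1 r s Hr Hs (Rlt_le_trans _ _ _ Hrs (Rmin_l _ _))).
    specialize (K2 r s Hr Hs (Rlt_le_trans _ _ _ Hrs (Rmin_r _ _))).
    replace (f s + g s - (f r + g r)) with ((f s - f r) + (g s - g r)) by ring.
    eapply Rle_trans; [apply Rabs_triang | lra].
Qed.

Lemma unif_diff01_opp f df : unif_diff01 f df -> unif_diff01 (fun r => - f r) (fun r => - df r).
Proof.
  intros [H1 H2]; split.
  - intros r Hr; apply (is_derive_opp (V := R_NormedModule)); auto.
  - intros e; destruct (H2 e) as [d K]; exists d; intros r s Hr Hs Hrs.
    replace (- f s - - f r) with (- (f s - f r)) by ring.
    rewrite Rabs_Ropp; auto.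
Qed.

Lemma unif_diff01_const f df : unif_diff01 f df -> (forall r, 0 < r < 1 -> df r = 0) -> f 0 = f 1.
Proof.
  intros [H1 H2] H0.
  assert (K : forall r s, 0 < r -> r < s -> s < 1 -> f r = f s).
  { intros r s Hr Hrs Hs.
    destruct (MVT_gen f r s df) as [c [Hc E]].
    - rewrite Rmin_left, Rmax_right by lra. intros x Hx; apply H1; lra.
    - rewrite Rmin_left, Rmax_right by lra. intros x Hx.
      apply continuity_pt_filterlim, (ex_derive_continuous (V := R_NormedModule)).
      exists (df x); apply H1; lra.
    - rewrite Rmin_left, Rmax_right in Hc by lra.
      rewrite H0 in E by lra. lra. }
  apply cond_eq. intros e He.
  assert (e3 : 0 < e / 3) by lra.
  destruct (H2 (mkposreal _ e3)) as [d Hd]; simpl in Hd.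
  set (t := Rmin (d / 2) (1 / 3)).
  assert (Ht : 0 < t /\ t < d /\ t <= 1 / 3).
  { destruct d as [d d0]; unfold t; simpl; repeat split.
    - apply Rmin_pos; lra.
    - eapply Rle_lt_trans; [apply Rmin_l | lra].
    - apply Rmin_r. }
  pose proof (Hd t 0 ltac:(lra) ltac:(lra) ltac:(rewrite Rabs_left; lra)).
  pose proof (Hd 1 (1 - t) ltac:(lra) ltac:(lra) ltac:(rewrite Rabs_left; lra)).
  rewrite (K t (1 - t)) in H by lra.
  replace (f 0 - f 1) with ((f 0 - f (1 - t)) + (f (1 - t) - f 1)) by ring.
  eapply Rle_lt_trans; [apply Rabs_triang | lra].
Qed.

(** Differentiation under the integral sign inside (0, 1); at the ends the
    joint continuity on the compact rectangle gives uniform continuity instead. *)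
Lemma unif_diff01_RInt_param (H D : R -> R -> R) a b : a <= b ->
  (forall r v, 0 <= r <= 1 -> continuity_2d_pt H r v) ->
  (forall r v, 0 < r < 1 -> is_derive (fun s => H s v) r (D r v)) ->
  (forall r v, 0 < r < 1 -> continuity_2d_pt D r v) ->
  unif_diff01 (fun r => RInt (H r) a b) (fun r => RInt (D r) a b).
Proof.
  intros Hab cH dH cD.
  assert (iH : forall r, 0 <= r <= 1 -> ex_RInt (H r) a b).
  { intros r Hr. apply (ex_RInt_continuous (V := R_CompleteNormedModule)). intros v _.
    intros P HP. specialize (cH r v Hr). apply continuity_2d_pt_filterlim in cH.
    destruct (cH P HP) as [d Hd]. exists d. intros y Hy.
    apply (Hd (r, y)). split; [apply ball_center | exact Hy]. }
  assert (near : forall r, 0 < r < 1 -> locally r (fun s => 0 < s < 1)).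
  { intros r Hr. apply filter_and; [apply open_gt | apply open_lt]; lra. }
  split.
  - intros r Hr. evar_last.
    + apply is_derive_RInt_param.
      * generalize (near r Hr); apply filter_imp. intros s Hs t _. eexists; apply dH; exact Hs.
      * intros t _. apply continuity_2d_pt_ext_loc with D; [|apply cD; exact Hr].
        destruct (near r Hr) as [d Hd]. exists d. intros u v Hu _.
        symmetry; apply is_derive_unique, dH, Hd. exact Hu.
      * generalize (near r Hr); apply filter_imp. intros s Hs; apply iH; lra.
    + apply RInt_ext. intros v _. apply is_derive_unique, dH, Hr.
  - intros e.
    assert (He : 0 < e / (b - a + 1)) by (apply Rdiv_lt_0_compat; [destruct e; auto | lra]).
    destruct (uniform_continuity_2d H 0 1 a b (fun x y Hx _ => cH x y Hx) (mkposreal _ He))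
      as [d Hd]. exists d. intros r s Hr Hs Hrs.
    change (Rabs (minus (RInt (H s) a b) (RInt (H r) a b)) <= e).
    rewrite <- (RInt_minus (V := R_CompleteNormedModule)) by (apply iH; assumption).
    eapply Rle_trans.
    + apply abs_RInt_le_const with (M := e / (b - a + 1)); [exact Hab | | ].
      * apply (ex_RInt_minus (V := R_NormedModule)); apply iH; assumption.
      * intros t Ht. left. apply (Hd r t s t); try assumption.
        rewrite Rminus_diag, Rabs_R0. destruct d; auto.
    + replace (pos e) with ((b - a + 1) * (e / (b - a + 1))) at 2 by (field; lra).
      apply Rmult_le_compat_r; lra.
Qed.

(** Composing with [clamp] turns data known on [a, b] into data with the same
    values that satisfies the same hypotheses on the whole line. *)
Definition clamp (a b v : R) := Rmax a (Rmin v b).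

Lemma clamp_in a b v : a <= b -> a <= clamp a b v <= b.
Proof.
  intros Hab; unfold clamp. split; [apply Rmax_l|].
  apply Rmax_lub; [exact Hab | apply Rmin_r].
Qed.

Lemma clamp_id a b v : a <= v <= b -> clamp a b v = v.
Proof. intros H; unfold clamp. rewrite Rmin_left, Rmax_right; lra. Qed.

Lemma clamp_cont a b v : a <= b -> continuous (clamp a b) v.
Proof.
  intros Hab P [d Hd]. exists d. intros y Hy. apply Hd.
  change (Rabs (y - v) < d) in Hy. change (Rabs (clamp a b y - clamp a b v) < d).
  eapply Rle_lt_trans; [|exact Hy].
  unfold clamp, Rmax, Rmin; repeat destruct Rle_dec; unfold Rabs; repeat destruct Rcase_abs; lra.
Qed.

Definition contract (w : C) (r : R) (u : C) : C := (w + RtoC r * (u - w))%C.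

Lemma contract_neq w r u : 0 < r -> u <> w -> contract w r u <> w.
Proof.
  intros Hr Hu E. apply Hu. unfold contract in E.
  destruct u as [x y], w as [x0 y0]. injection E; intros E1 E2; simpl in *.
  assert (K1 : r * (x - x0) = 0) by lra. assert (K2 : r * (y - y0) = 0) by lra.
  apply Rmult_integral in K1, K2.
  apply injective_projections; simpl; lra.
Qed.

(** What a radial deformation needs from the integrand: S is star-shaped about w,
    and h is holomorphic with derivative dh on S except at the centre, where
    continuity suffices.  Holomorphy appears as the chain rule along real paths,
    which makes sense although S need not be open. *)
Record star_holomorphic (h dh : C -> C) (w : C) (S : C -> Prop) : Prop := {
  star_closed : forall u r, S u -> 0 <= r <= 1 -> S (contract w r u);
  star_cont : forall u, S u -> Ccont (T := C_UniformSpace) h u;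
  star_dcont : forall u, S u -> u <> w -> Ccont (T := C_UniformSpace) dh u;
  star_chain : forall q t l, S (q t) -> q t <> w -> Cder q t l ->
    Cder (fun s => h (q s)) t (dh (q t) * l)%C }.

(** With q = contract w r p, the factor dp / (p - w) equals dq / (q - w): this is the
    form h(u) du / (u - w) pulled back along the contracted path.  In this writing
    it stays defined at r = 0. *)
Definition pullback (h : C -> C) (w : C) (p dp : R -> C) (r v : R) : C :=
  (h (contract w r (p v)) * (dp v / (p v - w)))%C.

(** Cauchy's theorem for one arc.  The r-derivative of the pulled back integrand is
    dh(contract r p) dp, which is also the v-derivative of h(contract r p) / r; hence
    the integral over the arc changes at the rate given by its two end points, and
    these rates cancel when arcs are chained into a closed contour. *)
Lemma star_piece h dh w S (p dp : R -> C) a b :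
  star_holomorphic h dh w S -> a <= b ->
  (forall v, a <= v <= b -> S (p v) /\ p v <> w /\ Cder p v (dp v) /\ Ccont dp v) ->
  let I r := CInt (pullback h w p dp r) a b in
  let B r := ((h (contract w r (p b)) - h (contract w r (p a))) / RtoC r)%C in
  unif_diff01 (fun r => Re (I r)) (fun r => Re (B r)) /\
  unif_diff01 (fun r => Im (I r)) (fun r => Im (B r)).
Proof.
  intros [S_star h_cont dh_cont h_der] Hab Hp I B.
  set (P := fun v => p (clamp a b v)). set (dP := fun v => dp (clamp a b v)).
  set (D := fun r v => (dh (contract w r (P v)) * dP v)%C).
  assert (Hp' : forall v, S (P v) /\ P v <> w /\ Ccont P v /\ Ccont dP v).
  { intros v. destruct (Hp _ (clamp_in a b v Hab)) as (H1 & H2 & H3 & H4).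
    split; [exact H1|]. split; [exact H2|].
    pose proof (clamp_cont a b v Hab) as Hc.
    split; unfold P, dP.
    - apply Cder_cont in H3. destruct H3; split;
        [apply (continuous_comp (clamp a b) (fun s => Re (p s)))
        |apply (continuous_comp (clamp a b) (fun s => Im (p s)))]; assumption.
    - destruct H4; split;
        [apply (continuous_comp (clamp a b) (fun s => Re (dp s)))
        |apply (continuous_comp (clamp a b) (fun s => Im (dp s)))]; assumption. }
  assert (snd_c : forall (f : R -> C) (x : R * R), Ccont f (snd x) ->
     Ccont (T := prod_UniformSpace R_UniformSpace R_UniformSpace) (fun x => f (snd x)) x).
  { intros f x [H1 H2]; split;
      [apply (continuous_comp (fun x : R * R => snd x) (fun s => Re (f s)))
      |apply (continuous_comp (fun x : R * R => snd x) (fun s => Im (f s)))];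
      try assumption; apply continuous_snd. }
  assert (cz : forall x : R * R,
     Ccont (T := prod_UniformSpace R_UniformSpace R_UniformSpace)
       (fun x => contract w (fst x) (P (snd x))) x).
  { intros x. apply Ccont_plus; [apply Ccont_const|]. apply Ccont_mult.
    - apply Ccont_RtoC, continuous_fst.
    - apply Ccont_minus; [|apply Ccont_const]. apply (snd_c P). exact (proj1 (proj2 (proj2 (Hp' _)))). }
  assert (cH : forall r v, 0 <= r <= 1 ->
     Ccont (T := prod_UniformSpace R_UniformSpace R_UniformSpace)
       (fun x => pullback h w P dP (fst x) (snd x)) (r, v)).
  { intros r v Hr. destruct (Hp' v) as (H1 & H2 & H3 & H4). apply Ccont_mult.
    - apply (Ccont_comp (fun x : R * R => contract w (fst x) (P (snd x))) h); [apply cz|].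
      apply h_cont, S_star; assumption.
    - apply Ccont_div; [apply (snd_c dP); exact H4| |].
      + apply Ccont_minus; [|apply Ccont_const]. apply (snd_c P); exact H3.
      + simpl. apply Cminus_eq_contra; exact H2. }
  assert (cD : forall r v, 0 < r < 1 ->
     Ccont (T := prod_UniformSpace R_UniformSpace R_UniformSpace)
       (fun x => D (fst x) (snd x)) (r, v)).
  { intros r v Hr. destruct (Hp' v) as (H1 & H2 & H3 & H4). apply Ccont_mult.
    - apply (Ccont_comp (fun x : R * R => contract w (fst x) (P (snd x))) dh); [apply cz|].
      apply dh_cont; [apply S_star; [exact H1 | simpl; lra] | apply contract_neq; [simpl; lra | exact H2]].
    - apply (snd_c dP); exact H4. }
  assert (dH : forall r v, 0 < r < 1 -> Cder (fun s => pullback h w P dP s v) r (D r v)).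
  { intros r v Hr. destruct (Hp' v) as (H1 & H2 & _ & _). unfold pullback, D.
    eapply Cder_eq.
    - apply Cder_mult; [|apply Cder_const].
      apply (h_der (fun s => contract w s (P v))).
      + apply S_star; [exact H1 | lra].
      + apply contract_neq; [lra | exact H2].
      + unfold contract. apply Cder_plus; [apply Cder_const|].
        apply Cder_mult; [apply Cder_RtoC, is_derive_id | apply Cder_const].
    - simpl. unfold one; simpl. field. apply Cminus_eq_contra; exact H2. }
  assert (eD : forall r, 0 < r < 1 ->
      RInt (fun v => Re (D r v)) a b = Re (B r) /\ RInt (fun v => Im (D r v)) a b = Im (B r)).
  { intros r Hr.
    assert (dB : forall v, a <= v <= b ->
       Cder (fun s => h (contract w r (p s)) / RtoC r)%C v (D r v)).
    { intros v Hv. destruct (Hp v Hv) as (H1 & H2 & H3 & H4). eapply Cder_eq.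
      - apply Cder_mult; [|apply Cder_const].
        apply (h_der (fun s => contract w r (p s))).
        + apply S_star; [exact H1 | lra].
        + apply contract_neq; [lra | exact H2].
        + unfold contract. apply Cder_plus; [apply Cder_const|].
          apply Cder_mult; [apply Cder_const|].
          apply Cder_minus; [exact H3 | apply Cder_const].
      - unfold D, P, dP; rewrite clamp_id by exact Hv. field.
        intros E; apply (f_equal Re) in E; simpl in E; lra. }
    assert (cB : forall v, Ccont (D r) v).
    { intros v. destruct (cD r v Hr) as [K1 K2].
      assert (L : continuous (fun s : R => (r, s) : R * R) v).
      { intros Q [d Hd]; exists d; intros y Hy; apply Hd; split;
          [apply ball_center | exact Hy]. }
      split; [exact (continuous_comp _ _ _ L K1) | exact (continuous_comp _ _ _ L K2)]. }
    split; apply is_RInt_unique.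
    - evar_last; [apply (is_RInt_derive (fun s => Re (h (contract w r (p s)) / RtoC r)))|].
      + rewrite Rmin_left, Rmax_right by exact Hab. intros v Hv; exact (proj1 (dB v Hv)).
      + intros v _; exact (proj1 (cB v)).
      + unfold B, Cdiv.
        generalize (h (contract w r (p b))) (h (contract w r (p a))) (/ RtoC r)%C.
        intros X Y Z; unfold minus, plus, opp, Re, Im; simpl; ring.
    - evar_last; [apply (is_RInt_derive (fun s => Im (h (contract w r (p s)) / RtoC r)))|].
      + rewrite Rmin_left, Rmax_right by exact Hab. intros v Hv; exact (proj2 (dB v Hv)).
      + intros v _; exact (proj2 (cB v)).
      + unfold B, Cdiv.
        generalize (h (contract w r (p b))) (h (contract w r (p a))) (/ RtoC r)%C.
        intros X Y Z; unfold minus, plus, opp, Re, Im; simpl; ring. }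
  assert (eI : forall r, I r = CInt (pullback h w P dP r) a b).
  { intros r. unfold I, CInt; f_equal; apply RInt_ext;
      rewrite Rmin_left, Rmax_right by exact Hab; intros v Hv;
      unfold pullback, P, dP; rewrite clamp_id by lra; reflexivity. }
  assert (ext : forall f f' df df', (forall r, f r = f' r) ->
     (forall r, 0 < r < 1 -> df r = df' r) -> unif_diff01 f df -> unif_diff01 f' df').
  { intros f f' df df' E1 E2 [T1 T2]; split.
    - intros r Hr. rewrite <- E2 by exact Hr. apply (is_derive_ext f); auto.
    - intros e; destruct (T2 e) as [d Hd]; exists d; intros r s Hr Hs Hrs.
      rewrite <- !E1; auto. }
  split.
  - apply (ext (fun r => RInt (fun v => Re (pullback h w P dP r v)) a b) _
      (fun r => RInt (fun v => Re (D r v)) a b)).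
    + intros r; rewrite eI; reflexivity.
    + intros r Hr; exact (proj1 (eD r Hr)).
    + apply (unif_diff01_RInt_param (fun r v => Re (pullback h w P dP r v)) (fun r v => Re (D r v)));
        [exact Hab | | |].
      * intros r v Hr; apply continuity_2d_pt_filterlim; exact (proj1 (cH r v Hr)).
      * intros r v Hr; exact (proj1 (dH r v Hr)).
      * intros r v Hr; apply continuity_2d_pt_filterlim; exact (proj1 (cD r v Hr)).
  - apply (ext (fun r => RInt (fun v => Im (pullback h w P dP r v)) a b) _
      (fun r => RInt (fun v => Im (D r v)) a b)).
    + intros r; rewrite eI; reflexivity.
    + intros r Hr; exact (proj2 (eD r Hr)).
    + apply (unif_diff01_RInt_param (fun r v => Im (pullback h w P dP r v)) (fun r v => Im (D r v)));
        [exact Hab | | |].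
      * intros r v Hr; apply continuity_2d_pt_filterlim; exact (proj2 (cH r v Hr)).
      * intros r v Hr; exact (proj2 (dH r v Hr)).
      * intros r v Hr; apply continuity_2d_pt_filterlim; exact (proj2 (cD r v Hr)).
Qed.

(** * The map u e^u and its inverse difference quotient *)

Definition zexp (u : C) : C := (u * Cexp u)%C.
Definition zexp' (u : C) : C := ((1 + u) * Cexp u)%C.

Lemma Cder_zexp q t l : Cder q t l -> Cder (fun s => zexp (q s)) t (zexp' (q t) * l)%C.
Proof.
  intros H. eapply Cder_eq.
  - apply Cder_mult; [exact H | apply Cder_exp; exact H].
  - unfold zexp'; simpl; ring.
Qed.

Lemma zexp_cont (u : C) : Ccont (T := C_UniformSpace) zexp u.
Proof. apply Ccont_mult; [|apply Ccont_exp]; apply Ccont_id. Qed.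

Lemma zexp'_cont (u : C) : Ccont (T := C_UniformSpace) zexp' u.
Proof.
  apply Ccont_mult; [|apply Ccont_exp; apply Ccont_id].
  apply Ccont_plus; [apply Ccont_const | apply Ccont_id].
Qed.

(** Mean value theorem for the components of E(q s) - s E'(w) (u - w) on the segment
    q from w to u: its derivative is (E'(q s) - E'(w)) (u - w), small near w. *)
Lemma zexp_taylor1 (w : C) (e : posreal) :
  locally (T := C_UniformSpace) w
    (fun u => Cmod (zexp u - zexp w - zexp' w * (u - w)) <= e * Cmod (u - w)).
Proof.
  assert (e2 : 0 < e / 2) by (destruct e; simpl; lra).
  destruct (Ccont_near _ _ (zexp'_cont w) (mkposreal _ e2)) as [d Hd]. simpl in Hd.
  exists d. refine (fun (u : C) Hu => _).
  set (q := fun s => contract w s u).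
  assert (Hq : forall s, 0 <= s <= 1 -> Cmod (zexp' (q s) - zexp' w) <= e / 2).
  { intros s Hs. apply Hd. destruct Hu as [H1 H2].
    change (Rabs (fst u - fst w) < d) in H1. change (Rabs (snd u - snd w) < d) in H2.
    assert (K : forall x, Rabs x < d -> Rabs (s * x) < d).
    { intros x Hx. rewrite Rabs_mult, (Rabs_right s) by lra.
      pose proof (Rabs_pos x). nra. }
    apply K in H1, H2.
    split.
    - change (Rabs (fst (q s) - fst w) < d). unfold q, contract; simpl.
      replace (_ - fst w) with (s * (fst u - fst w)) by ring. exact H1.
    - change (Rabs (snd (q s) - snd w) < d). unfold q, contract; simpl.
      replace (_ - snd w) with (s * (snd u - snd w)) by ring. exact H2. }
  set (F := fun s => (zexp (q s) - RtoC s * (zexp' w * (u - w)))%C).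
  assert (dF : forall s, Cder F s ((zexp' (q s) - zexp' w) * (u - w))%C).
  { intros s. eapply Cder_eq.
    - apply Cder_minus.
      + apply Cder_zexp. unfold q, contract. apply Cder_plus; [apply Cder_const|].
        apply Cder_mult; [apply Cder_RtoC, is_derive_id | apply Cder_const].
      + apply Cder_mult; [apply Cder_RtoC, is_derive_id | apply Cder_const].
    - unfold one; simpl; ring. }
  assert (E : (zexp u - zexp w - zexp' w * (u - w) = F 1 - F 0)%C).
  { unfold F, q, contract. replace (w + 1 * (u - w))%C with u by ring.
    replace (w + 0 * (u - w))%C with w by ring. ring. }
  rewrite E.
  assert (bd : forall s, 0 <= s <= 1 ->
     Cmod ((zexp' (q s) - zexp' w) * (u - w)) <= e / 2 * Cmod (u - w)).
  { intros s Hs. rewrite Cmod_mult. apply Rmult_le_compat_r; [apply Cmod_ge_0 | auto]. }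
  assert (mv : forall g dg : R -> R, (forall s, is_derive g s (dg s)) ->
     (forall s, 0 <= s <= 1 -> Rabs (dg s) <= e / 2 * Cmod (u - w)) ->
     Rabs (g 1 - g 0) <= e / 2 * Cmod (u - w)).
  { intros g dg Hg Hb. destruct (MVT_gen g 0 1 dg) as [c [Hc Ec]].
    - intros; apply Hg.
    - intros x _. apply continuity_pt_filterlim, (ex_derive_continuous (V := R_NormedModule)).
      exists (dg x); apply Hg.
    - rewrite Rmin_left, Rmax_right in Hc by lra.
      rewrite Ec, Rminus_0_r, Rmult_1_r. apply Hb; exact Hc. }
  eapply Rle_trans; [apply Cmod_le_sum|].
  pose proof (mv _ _ (fun s => proj1 (dF s))
    (fun s Hs => Rle_trans _ _ _ (re_le_Cmod _) (bd s Hs))) as M1.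
  pose proof (mv _ _ (fun s => proj2 (dF s))
    (fun s Hs => Rle_trans _ _ _ (im_le_Cmod _) (bd s Hs))) as M2.
  change (Rabs (Re (F 1) - Re (F 0)) + Rabs (Im (F 1) - Im (F 0)) <= e * Cmod (u - w)).
  lra.
Qed.

(** (u - w) / (E(u) - E(w)), continued to u = w: the function h of the introduction,
    which removes the pole of 1 / (E - E(w)). *)
Definition invquot (w u : C) : C :=
  if Req_EM_T (Cmod (u - w)) 0 then (/ zexp' w)%C
  else ((u - w) / (zexp u - zexp w))%C.

Definition invquot' (w u : C) : C :=
  (((zexp u - zexp w) - (u - w) * zexp' u) / ((zexp u - zexp w) * (zexp u - zexp w)))%C.

Lemma Cmod_sub_eq0 (u w : C) : Cmod (u - w) = 0 -> u = w.
Proof. intros H; apply Cmod_eq_0 in H. apply Ceq_minus; exact H. Qed.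

Lemma invquot_at w : invquot w w = (/ zexp' w)%C.
Proof.
  unfold invquot. destruct Req_EM_T as [_|n]; [reflexivity|].
  exfalso; apply n. replace (w - w)%C with (RtoC 0) by ring. apply Cmod_0.
Qed.

Lemma invquot_neq w u : u <> w -> invquot w u = ((u - w) / (zexp u - zexp w))%C.
Proof.
  intros H; unfold invquot. destruct Req_EM_T as [e|_]; [|reflexivity].
  elim H; apply Cmod_sub_eq0; exact e.
Qed.

Lemma Ccont_neq {T : UniformSpace} (f : T -> C) x c : Ccont f x -> f x <> c ->
  locally x (fun t => f t <> c).
Proof.
  intros Hf Hc.
  assert (K : 0 < Cmod (f x - c)).
  { apply Cmod_gt_0. apply Cminus_eq_contra; exact Hc. }
  assert (K2 : 0 < Cmod (f x - c) / 2) by lra.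
  generalize (Ccont_near f x Hf (mkposreal _ K2)). apply filter_imp. simpl.
  intros t Ht E. rewrite E in Ht.
  replace (c - f x)%C with (- (f x - c))%C in Ht by ring. rewrite Cmod_opp in Ht. lra.
Qed.

Lemma invquot_cont_at (w : C) : zexp' w <> 0%C -> Ccont (T := C_UniformSpace) (invquot w) w.
Proof.
  intros Hw.
  set (Q := fun u : C => if Req_EM_T (Cmod (u - w)) 0 then zexp' w
     else ((zexp u - zexp w) / (u - w))%C).
  assert (Qw : Q w = zexp' w).
  { unfold Q. destruct Req_EM_T as [_|n]; [reflexivity|].
    elim n. replace (w - w)%C with (RtoC 0) by ring. apply Cmod_0. }
  assert (HQ : Ccont (T := C_UniformSpace) Q w).
  { apply Ccont_eps. intros e. generalize (zexp_taylor1 w e). apply filter_imp.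
    refine (fun (u : C) Hu => _). rewrite Qw. unfold Q. destruct Req_EM_T as [E|n].
    - replace (zexp' w - zexp' w)%C with (RtoC 0) by ring. rewrite Cmod_0.
      destruct e; simpl; lra.
    - assert (Hn : (u - w <> 0)%C) by (intros E; apply n; rewrite E; apply Cmod_0).
      replace ((zexp u - zexp w) / (u - w) - zexp' w)%C
        with ((zexp u - zexp w - zexp' w * (u - w)) / (u - w))%C by (field; exact Hn).
      rewrite Cmod_div by exact Hn.
      apply Rle_div_l; [apply Cmod_gt_0; exact Hn | exact Hu]. }
  apply (Ccont_ext_loc (fun u : C_UniformSpace => (/ Q u)%C)).
  - assert (H0 : Q w <> RtoC 0) by (rewrite Qw; exact Hw).
    generalize (Ccont_neq (T := C_UniformSpace) Q w 0 HQ H0). apply filter_imp.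
    refine (fun (u : C) Hu => _). revert Hu. unfold Q, invquot.
    destruct Req_EM_T as [E|n]; intros Hu; [reflexivity|].
    assert (Hn : (u - w <> 0)%C) by (intros E; apply n; rewrite E; apply Cmod_0).
    assert (Hm : (zexp u - zexp w <> 0)%C).
    { intros E; apply Hu; rewrite E; unfold Cdiv; ring. }
    field; split; assumption.
  - apply Ccont_inv; [exact HQ | rewrite Qw; exact Hw].
Qed.

Lemma invquot_star w (S : C -> Prop) :
  (forall u r, S u -> 0 <= r <= 1 -> S (contract w r u)) ->
  (forall u, S u -> zexp u = zexp w -> u = w) -> zexp' w <> 0%C ->
  star_holomorphic (invquot w) (invquot' w) w S.
Proof.
  intros Hstar Hinj Hw.
  assert (nz : forall u, S u -> u <> w -> (zexp u - zexp w <> 0)%C).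
  { intros u Hu Hn. apply Cminus_eq_contra. intros E; apply Hn, Hinj; assumption. }
  assert (cE : forall u, Ccont (T := C_UniformSpace) (fun u => zexp u - zexp w)%C u).
  { intros u; apply Ccont_minus; [apply zexp_cont | apply Ccont_const]. }
  assert (ci : forall u : C, Ccont (T := C_UniformSpace) (fun u => u - w)%C u).
  { intros u; apply Ccont_minus; [apply Ccont_id | apply Ccont_const]. }
  split.
  - exact Hstar.
  - intros u Hu. destruct (Req_EM_T (Cmod (u - w)) 0) as [E|n].
    + apply Cmod_sub_eq0 in E; subst u; apply invquot_cont_at; exact Hw.
    + assert (Hn : u <> w).
      { intros E; apply n; rewrite E; replace (w - w)%C with (RtoC 0) by ring; apply Cmod_0. }
      apply (Ccont_ext_loc (fun u : C_UniformSpace => ((u - w) / (zexp u - zexp w))%C)).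
      * generalize (Ccont_neq (T := C_UniformSpace) (fun u => u) u w (Ccont_id u) Hn).
        apply filter_imp. intros t Ht; symmetry; apply invquot_neq; exact Ht.
      * apply Ccont_div; [apply ci | apply cE | apply nz; assumption].
  - intros u Hu Hn. apply Ccont_div.
    + apply Ccont_minus; [apply cE | apply Ccont_mult; [apply ci | apply zexp'_cont]].
    + apply Ccont_mult; apply cE.
    + apply Cmult_neq_0; apply nz; assumption.
  - intros q t l Hq Hn Hd.
    apply (Cder_ext_loc (fun s => (q s - w) / (zexp (q s) - zexp w))%C).
    + generalize (Ccont_neq q t w (Cder_cont _ _ _ Hd) Hn). apply filter_imp.
      intros s Hs; symmetry; apply invquot_neq; exact Hs.
    + eapply Cder_eq.
      * apply Cder_div; [| |apply nz; assumption].
        -- apply Cder_minus; [exact Hd | apply Cder_const].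
        -- apply Cder_minus; [apply Cder_zexp; exact Hd | apply Cder_const].
      * unfold invquot'. field. apply nz; assumption.
Qed.

(** * The range of the principal branch *)

Lemma Re_zexp u : Re (zexp u) = exp (Re u) * (Re u * cos (Im u) - Im u * sin (Im u)).
Proof. unfold zexp, Cexp, Re, Im; simpl; ring. Qed.

Lemma Im_zexp u : Im (zexp u) = exp (Re u) * (Re u * sin (Im u) + Im u * cos (Im u)).
Proof. unfold zexp, Cexp, Re, Im; simpl; ring. Qed.

Lemma Cconj_Re u : Re (Cconj u) = Re u. Proof. reflexivity. Qed.
Lemma Cconj_Im u : Im (Cconj u) = - Im u. Proof. reflexivity. Qed.

Lemma zexp_conj u : zexp (Cconj u) = Cconj (zexp u).
Proof.
  apply injective_projections; [change (Re (zexp (Cconj u)) = Re (zexp u))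
    | change (Im (zexp (Cconj u)) = - Im (zexp u))];
  rewrite ?Re_zexp, ?Im_zexp, Cconj_Re, Cconj_Im, cos_neg, sin_neg; ring.
Qed.

Lemma MVT_closed f df a b : a < b -> (forall x, a <= x <= b -> is_derive f x (df x)) ->
  exists c, a <= c <= b /\ f b - f a = df c * (b - a).
Proof.
  intros Hab Hf. destruct (MVT_gen f a b df) as [c [Hc E]].
  - rewrite Rmin_left, Rmax_right by lra. intros x Hx; apply Hf; lra.
  - rewrite Rmin_left, Rmax_right by lra. intros x Hx.
    apply continuity_pt_filterlim, (ex_derive_continuous (V := R_NormedModule)).
    exists (df x); apply Hf; lra.
  - rewrite Rmin_left, Rmax_right in Hc by lra. exists c; auto.
Qed.

Lemma y_cos_lt_sin y : 0 < y -> y < PI -> y * cos y < sin y.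
Proof.
  intros H0 Hpi.
  assert (K : 0 < y / 2 < PI) by lra.
  destruct (MVT_closed (fun t => sin t - t * cos t) (fun t => t * sin t) (y / 2) y)
    as [c [Hc E]]; [lra| |].
  - intros x _. auto_derive; [trivial | ring].
  - destruct (MVT_closed (fun t => sin t - t * cos t) (fun t => t * sin t) 0 (y / 2))
      as [c' [Hc' E']]; [lra| |].
    + intros x _. auto_derive; [trivial | ring].
    + simpl in *. rewrite sin_0, Rmult_0_l in E'.
      assert (0 < c * sin c) by (apply Rmult_lt_0_compat; [lra | apply sin_gt_0; lra]).
      assert (0 <= c' * sin c') by (apply Rmult_le_pos; [lra | apply sin_ge_0; lra]).
      nra.
Qed.

(** -v cot v, the real part of the boundary curve of Omega at height v. *)
Definition edge_x (y : R) : R := - (y * cos y) / sin y.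
Definition edge_x' (y : R) : R := (y - sin y * cos y) / sin y ^ 2.

Lemma edge_x_der y : sin y <> 0 -> is_derive edge_x y (edge_x' y).
Proof.
  intros H; unfold edge_x, edge_x'. auto_derive; [exact H|].
  replace (y - sin y * cos y) with
    (y * ((sin y)² + (cos y)²) - sin y * cos y) by (rewrite sin2_cos2; ring).
  unfold Rsqr; field; exact H.
Qed.

Lemma edge_x'_der y : sin y <> 0 ->
  is_derive edge_x' y (2 * (sin y - y * cos y) / sin y ^ 3).
Proof.
  intros H; unfold edge_x'. auto_derive; [repeat split; auto; apply Rmult_integral_contrapositive; lra|].
  replace (2 * (sin y - y * cos y)) with
    (sin y + sin y * ((sin y)² + (cos y)²) - 2 * y * cos y) by (rewrite sin2_cos2; ring).
  unfold Rsqr; field; exact H.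
Qed.

(** -v cot v is convex on (0, PI): its second derivative is positive by
    [y_cos_lt_sin]. *)
Lemma edge_x_tangent y0 y : 0 < y0 < PI -> 0 < y < PI ->
  edge_x y0 + edge_x' y0 * (y - y0) <= edge_x y.
Proof.
  intros H0 Hy.
  assert (sp : forall t, 0 < t < PI -> 0 < sin t) by (intros; apply sin_gt_0; lra).
  assert (mono : forall s t, 0 < s -> s <= t -> t < PI -> edge_x' s <= edge_x' t).
  { intros s t Hs [Hst| ->] Ht; [|lra].
    destruct (MVT_closed edge_x' (fun y => 2 * (sin y - y * cos y) / sin y ^ 3) s t Hst)
      as [c [Hc E]].
    - intros x Hx. apply edge_x'_der. specialize (sp x); lra.
    - pose proof (y_cos_lt_sin c ltac:(lra) ltac:(lra)).
      assert (0 <= 2 * (sin c - c * cos c) / sin c ^ 3).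
      { apply Rle_div_r; [apply pow_lt, sp; lra | lra]. }
      nra. }
  destruct (Rtotal_order y0 y) as [L|[->|L]].
  - destruct (MVT_closed edge_x edge_x' y0 y L) as [c [Hc E]].
    + intros x Hx; apply edge_x_der. specialize (sp x); lra.
    + pose proof (mono y0 c). nra.
  - lra.
  - destruct (MVT_closed edge_x edge_x' y y0 L) as [c [Hc E]].
    + intros x Hx; apply edge_x_der. specialize (sp x); lra.
    + pose proof (mono c y0). nra.
Qed.

(** The closure of the range of the principal branch.  Off the real axis the last
    condition says Re u >= - Im u * cot (Im u); multiplied by the square of the sine
    it covers both half-planes in one polynomial inequality and is void on the real
    axis, where the second condition takes over. *)
Definition Omega (u : C) : Prop :=
  - PI < Im u < PI /\ -1 <= Re u /\
  0 <= Re u * sin (Im u) ^ 2 + Im u * sin (Im u) * cos (Im u).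

Lemma Omega_conj u : Omega u -> Omega (Cconj u).
Proof.
  unfold Omega. rewrite Cconj_Re, Cconj_Im, cos_neg, sin_neg. intros [H1 [H2 H3]].
  split; [lra|]. split; [exact H2|]. nra.
Qed.

(** The tangents of the upper boundary curve are supporting lines of all of Omega:
    the lower half follows by conjugation, since these tangents have nonnegative
    slope dx/dy, and -1 - (edge_x y0 - y0 edge_x' y0) >= 0 settles the real axis. *)
Lemma Omega_tangent u y0 : Omega u -> 0 < y0 < PI ->
  edge_x y0 + edge_x' y0 * (Im u - y0) <= Re u.
Proof.
  assert (pos : forall u, Omega u -> 0 <= Im u -> 0 < y0 < PI ->
     edge_x y0 + edge_x' y0 * (Im u - y0) <= Re u).
  { clear u. intros u (H1 & H2 & H3) [Hp|H0] Hy0.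
    - assert (Hs : 0 < sin (Im u)) by (apply sin_gt_0; lra).
      eapply Rle_trans; [apply edge_x_tangent; lra|].
      unfold edge_x. apply Rle_div_l; [exact Hs|]. nra.
    - rewrite <- H0. assert (Hs : 0 < sin y0) by (apply sin_gt_0; lra).
      replace (edge_x y0 + edge_x' y0 * (0 - y0)) with (- (y0 / sin y0) ^ 2)
        by (unfold edge_x, edge_x'; field; lra).
      assert (1 <= y0 / sin y0).
      { apply Rle_div_r; [exact Hs|]. rewrite Rmult_1_l. left; apply sin_lt_x; lra. }
      nra. }
  intros Hu Hy0. destruct (Rle_dec 0 (Im u)) as [L|L]; [auto|].
  pose proof (pos (Cconj u) (Omega_conj u Hu)) as K. rewrite Cconj_Re, Cconj_Im in K.
  specialize (K ltac:(lra) Hy0).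
  assert (0 <= edge_x' y0).
  { assert (Hs : 0 < sin y0) by (apply sin_gt_0; lra).
    unfold edge_x'. apply Rle_div_r; [apply pow_lt, Hs|].
    pose proof (sin_lt_x y0 ltac:(lra)). pose proof (COS_bound y0). nra. }
  nra.
Qed.

(** A point of a segment in the open upper half-plane satisfies the inequality of
    Omega because both ends lie to the right of the tangent at its height. *)
Lemma Omega_convex w u r : Omega w -> Omega u -> 0 <= r <= 1 -> Omega (contract w r u).
Proof.
  assert (up : forall w u, Omega w -> Omega u -> 0 <= r <= 1 -> 0 < Im (contract w r u) ->
     Omega (contract w r u)).
  { clear. intros w u Hw Hu Hr.
    assert (ER : Re (contract w r u) = Re w + r * (Re u - Re w))
      by (unfold contract, Re, Im; simpl; ring).
    assert (EI : Im (contract w r u) = Im w + r * (Im u - Im w))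
      by (unfold contract, Re, Im; simpl; ring).
    set (y0 := Im (contract w r u)) in *. intros Hy.
    assert (Hy0 : 0 < y0 < PI).
    { split; [exact Hy|]. destruct Hw as [[Hw1 Hw2] _], Hu as [[Hu1 Hu2] _].
      assert (0 <= (1 - r) * (PI - Im w)) by (apply Rmult_le_pos; lra).
      assert (0 <= r * (PI - Im u)) by (apply Rmult_le_pos; lra).
      destruct (Req_dec r 1) as [->|N]; [lra|].
      assert (0 < (1 - r) * (PI - Im w)) by (apply Rmult_lt_0_compat; lra). lra. }
    pose proof (Omega_tangent w y0 Hw Hy0). pose proof (Omega_tangent u y0 Hu Hy0).
    unfold Omega; fold y0; rewrite ER. split; [lra|].
    destruct Hw as (_ & Hw & _), Hu as (_ & Hu & _). split; [nra|].
    assert (Hs : 0 < sin y0) by (apply sin_gt_0; lra).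
    assert (K : edge_x y0 <= Re w + r * (Re u - Re w)).
    { assert (edge_x y0 = (1 - r) * (edge_x y0 + edge_x' y0 * (Im w - y0)) +
         r * (edge_x y0 + edge_x' y0 * (Im u - y0))) by (rewrite EI; ring).
      assert ((1 - r) * (edge_x y0 + edge_x' y0 * (Im w - y0)) <= (1 - r) * Re w)
        by (apply Rmult_le_compat_l; lra).
      assert (r * (edge_x y0 + edge_x' y0 * (Im u - y0)) <= r * Re u)
        by (apply Rmult_le_compat_l; lra).
      lra. }
    unfold edge_x in K. apply Rle_div_l in K; [|exact Hs].
    replace (_ + _) with (sin y0 * ((Re w + r * (Re u - Re w)) * sin y0 - - (y0 * cos y0)))
      by ring.
    apply Rmult_le_pos; lra. }
  intros Hw Hu Hr. destruct (Rtotal_order (Im (contract w r u)) 0) as [L|[L|L]].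
  - assert (E : Cconj (contract w r u) = contract (Cconj w) r (Cconj u)).
    { unfold contract. apply injective_projections; simpl; ring. }
    rewrite <- (Cconj_conj (contract w r u)). apply Omega_conj. rewrite E.
    apply up; try apply Omega_conj; try assumption. rewrite <- E, Cconj_Im. lra.
  - unfold Omega; rewrite L. rewrite sin_0. pose proof PI_RGT_0.
    destruct Hw as (_ & Hw & _), Hu as (_ & Hu & _).
    split; [lra|]. split; [|lra].
    replace (Re (contract w r u)) with (Re w + r * (Re u - Re w))
      by (unfold contract, Re, Im; simpl; ring). nra.
  - apply up; assumption.
Qed.

(** The argument, in the form valid on the upper half-plane. *)
Definition upper_arg (u : C) : R := PI / 2 - atan (Re u / Im u).

Lemma upper_arg_polar u : 0 < Im u ->
  0 < upper_arg u < PI /\ 0 < Cmod u /\ Re u = Cmod u * cos (upper_arg u) /\ Im u = Cmod u * sin (upper_arg u).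
Proof.
  intros Hy. unfold upper_arg.
  pose proof (atan_bound (Re u / Im u)) as Hb.
  split; [lra|].
  assert (Hm : Cmod u = Im u * sqrt (1 + (Re u / Im u)²)).
  { rewrite <- (sqrt_Rsqr (Im u)) at 1 by lra.
    rewrite <- sqrt_mult_alt by apply Rle_0_sqr. unfold Cmod. f_equal.
    unfold Rsqr. change (Re u ^ 2 + Im u ^ 2 = Im u * Im u * (1 + Re u / Im u * (Re u / Im u))).
    field; lra. }
  assert (Hs : 0 < sqrt (1 + (Re u / Im u)²)).
  { apply sqrt_lt_R0. pose proof (Rle_0_sqr (Re u / Im u)); lra. }
  rewrite cos_shift, sin_shift, sin_atan, cos_atan, Hm.
  split; [apply Rmult_lt_0_compat; assumption|].
  split; field; repeat split; lra.
Qed.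

(** u + log u is injective on the upper half-plane, because its derivative 1 + 1/u has
    negative imaginary part there and the half-plane is convex.  Under the present
    hypotheses E(u) = exp (u + log u) with Im (u + log u) in (0, PI), so that equal
    values of E force equal values of u + log u. *)
Lemma zexp_inj_upper u w : 0 < Im u < PI -> 0 < Im w < PI ->
  0 < Im (zexp u) -> zexp u = zexp w -> u = w.
Proof.
  intros Hu Hw Hq E.
  destruct (upper_arg_polar u) as (Tu & Mu & Xu & Yu); [lra|].
  destruct (upper_arg_polar w) as (Tw & Mw & Xw & Yw); [lra|].
  assert (PR : forall v, Re v = Cmod v * cos (upper_arg v) -> Im v = Cmod v * sin (upper_arg v) ->
     Re (zexp v) = exp (Re v) * Cmod v * cos (Im v + upper_arg v) /\
     Im (zexp v) = exp (Re v) * Cmod v * sin (Im v + upper_arg v)).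
  { intros v Hx Hy. rewrite Re_zexp, Im_zexp, cos_plus, sin_plus.
    set (c := cos (upper_arg v)) in *; set (s := sin (upper_arg v)) in *; set (m := Cmod v) in *.
    split.
    - transitivity (exp (Re v) * (m * c * cos (Im v) - m * s * sin (Im v))); [|ring].
      rewrite <- Hx, <- Hy; ring.
    - transitivity (exp (Re v) * (m * c * sin (Im v) + m * s * cos (Im v))); [|ring].
      rewrite <- Hx, <- Hy; ring. }
  destruct (PR u Xu Yu) as [Ru Iu]. destruct (PR w Xw Yw) as [Rw Iw].
  assert (Eu : 0 < exp (Re u) * Cmod u) by (apply Rmult_lt_0_compat; [apply exp_pos | exact Mu]).
  assert (Ew : 0 < exp (Re w) * Cmod w) by (apply Rmult_lt_0_compat; [apply exp_pos | exact Mw]).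
  assert (Hr : exp (Re u) * Cmod u = exp (Re w) * Cmod w).
  { assert (S : forall m a, (m * cos a)² + (m * sin a)² = m²).
    { intros m a. pose proof (sin2_cos2 a) as T. unfold Rsqr in *.
      replace (m * m) with (m * m * (sin a * sin a + cos a * cos a)) by (rewrite T; ring). ring. }
    apply Rsqr_inj; try lra.
    rewrite <- (S (exp (Re u) * _) (Im u + upper_arg u)), <- (S (exp (Re w) * Cmod w) (Im w + upper_arg w)), <- Ru, <- Iu, <- Rw, <- Iw, E.
    reflexivity. }
  assert (lt_pi : forall v, 0 < exp (Re v) * Cmod v -> 0 < Im (zexp v) ->
     Im (zexp v) = exp (Re v) * Cmod v * sin (Im v + upper_arg v) ->
     0 < Im v < PI -> 0 < upper_arg v < PI -> Im v + upper_arg v < PI).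
  { intros v H1 H2 H3 H4 H5. destruct (Rlt_dec (Im v + upper_arg v) PI) as [L|L]; [exact L|].
    pose proof (sin_le_0 (Im v + upper_arg v) ltac:(lra) ltac:(lra)). nra. }
  assert (Ha : Im u + upper_arg u = Im w + upper_arg w).
  { assert (Hc : cos (Im u + upper_arg u) = cos (Im w + upper_arg w)).
    { apply Rmult_eq_reg_l with (exp (Re u) * Cmod u); [|lra].
      rewrite <- Ru, Hr, <- Rw, E; reflexivity. }
    pose proof (lt_pi u Eu Hq Iu Hu Tu). rewrite E in Hq.
    pose proof (lt_pi w Ew Hq Iw Hw Tw).
    destruct (Rtotal_order (Im u + upper_arg u) (Im w + upper_arg w)) as [L|[L|L]]; [|exact L|];
      apply cos_decreasing_1 in L; lra. }
  assert (Hl : Re u + ln (Cmod u) = Re w + ln (Cmod w)).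
  { apply exp_inv. rewrite !exp_plus, !exp_ln by assumption. exact Hr. }
  (* With d = w - u, phi is Im (conj d * (s + log s)) along the segment, and
     its derivative is |d|^2 Im (1 + 1/s) < 0. *)
  set (dx := Re w - Re u). set (dy := Im w - Im u).
  set (X := fun s => Re u + s * dx). set (Y := fun s => Im u + s * dy).
  set (phi := fun s => dx * (Y s + (PI / 2 - atan (X s / Y s)))
     - dy * (X s + ln (X s ^ 2 + Y s ^ 2) / 2)).
  assert (Yp : forall s, 0 <= s <= 1 -> 0 < Y s) by (intros s Hs; unfold Y, dy; nra).
  destruct (MVT_closed phi (fun s => - (Y s * (dx ^ 2 + dy ^ 2)) / (X s ^ 2 + Y s ^ 2)) 0 1)
    as [c [Hc Ec]]; [lra| |].
  { intros s Hs. specialize (Yp s Hs).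
    assert (0 < X s ^ 2 + Y s ^ 2) by nra.
    unfold phi, X, Y in *. auto_derive.
    - repeat split; simpl in *; lra.
    - field. simpl in *. repeat split; nra. }
  assert (lnm : forall v, 0 < Cmod v -> ln (Cmod v) = ln (Re v ^ 2 + Im v ^ 2) / 2).
  { intros v Hv. rewrite <- Cmod2_alt. replace (Cmod v ^ 2) with (Cmod v * Cmod v) by ring.
    rewrite ln_mult by assumption. field. }
  assert (E01 : phi 1 = phi 0).
  { unfold phi, X, Y. rewrite !Rmult_0_l, !Rmult_1_l, !Rplus_0_r.
    replace (Re u + dx) with (Re w) by (unfold dx; ring).
    replace (Im u + dy) with (Im w) by (unfold dy; ring).
    rewrite <- !lnm by assumption. fold (upper_arg u) (upper_arg w). rewrite Ha, Hl. reflexivity. }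
  rewrite E01 in Ec.
  assert (Hd : dx ^ 2 + dy ^ 2 = 0).
  { specialize (Yp c Hc). assert (P : 0 < X c ^ 2 + Y c ^ 2) by nra.
    assert (Z : - (Y c * (dx ^ 2 + dy ^ 2)) / (X c ^ 2 + Y c ^ 2) = 0) by lra.
    apply Rmult_integral in Z. destruct Z as [Z|Z].
    - apply Ropp_eq_0_compat in Z. rewrite Ropp_involutive in Z.
      apply Rmult_integral in Z; lra.
    - apply Rinv_neq_0_compat in Z; [elim Z | lra]. }
  assert (dx = 0) by nra. assert (dy = 0) by nra. unfold dx, dy, Re, Im in *.
  apply injective_projections; lra.
Qed.

Lemma Omega_upper u : Omega u -> 0 < Im (zexp u) -> 0 < Im u < PI.
Proof.
  intros (H1 & H2 & H3) Hq. rewrite Im_zexp in Hq. split; [|lra].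
  assert (q : 0 < Re u * sin (Im u) + Im u * cos (Im u)).
  { pose proof (exp_pos (Re u)). nra. }
  destruct (Rtotal_order 0 (Im u)) as [L|[L|L]]; [exact L| |].
  - rewrite <- L, sin_0 in q. lra.
  - assert (sin (Im u) < 0) by (apply sin_lt_0_var; lra). nra.
Qed.

(** In the strip |Im u| < PI, off the real axis, a real value of u e^u is negative:
    there u sin y = - y e^(-iy) with y = Im u, so the value has the sign of
    - y / sin y. *)
Lemma zexp_real u : - PI < Im u < PI -> Im (zexp u) = 0 -> 0 < Re (zexp u) ->
  Im u = 0 /\ 0 < Re u.
Proof.
  intros H1. rewrite Re_zexp, Im_zexp. intros Hi Hr.
  pose proof (exp_pos (Re u)) as He.
  apply Rmult_integral in Hi. destruct Hi as [Hi|Hi]; [lra|].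
  assert (Hr' : 0 < Re u * cos (Im u) - Im u * sin (Im u)) by nra.
  assert (H0 : Im u = 0).
  { destruct (Req_dec (Im u) 0) as [E|N]; [exact E|]. exfalso.
    assert (P : 0 < Im u * sin (Im u)).
    { destruct (Rtotal_order 0 (Im u)) as [L|[L|L]]; [|lra|].
      - apply Rmult_lt_0_compat; [lra | apply sin_gt_0; lra].
      - assert (sin (Im u) < 0) by (apply sin_lt_0_var; lra). nra. }
    pose proof (sin2_cos2 (Im u)) as T. unfold Rsqr in T.
    assert ((Re u * cos (Im u) - Im u * sin (Im u)) * (Im u * sin (Im u)) = - Im u ^ 2).
    { transitivity (Im u * (cos (Im u) * (Re u * sin (Im u)) - Im u * (sin (Im u) * sin (Im u)))); [ring|].
      replace (Re u * sin (Im u)) with (- (Im u * cos (Im u))) by lra.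
      replace (sin (Im u) * sin (Im u)) with (1 - cos (Im u) * cos (Im u)) by lra. ring. }
    assert (0 < Im u ^ 2) by nra. nra. }
  rewrite H0, cos_0, sin_0 in Hr'. lra.
Qed.

(** On Omega the sign of Im E(u) forces that of Im u, so the three cases
    Im E(w) > 0, = 0, < 0 live in the upper half-plane, on the positive real axis
    and in the lower half-plane. *)
Lemma zexp_inj_Omega u w : Omega u -> Omega w -> cut_plane 0 (zexp w) ->
  zexp u = zexp w -> u = w.
Proof.
  intros Hu Hw Hz E. destruct (Rtotal_order 0 (Im (zexp w))) as [L|[L|L]].
  - assert (Lu : 0 < Im (zexp u)) by (rewrite E; exact L).
    exact (zexp_inj_upper u w (Omega_upper u Hu Lu) (Omega_upper w Hw L) Lu E).
  - assert (Hr : 0 < Re (zexp w)).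
    { apply Rnot_le_lt. intros K; apply Hz; split; [symmetry; exact L | exact K]. }
    destruct (zexp_real w) as [W1 W2]; [apply Hw | symmetry; exact L | exact Hr |].
    destruct (zexp_real u) as [U1 U2]; [apply Hu | rewrite E; symmetry; exact L | rewrite E; exact Hr |].
    assert (K : Re (zexp u) = Re (zexp w)) by (rewrite E; reflexivity).
    rewrite !Re_zexp, U1, W1, cos_0, sin_0 in K.
    assert (M : forall a b, 0 < a -> a < b -> exp a * a < exp b * b).
    { intros a b H1 H2. pose proof (exp_increasing a b H2). pose proof (exp_pos a). nra. }
    apply injective_projections; [|change (Im u = Im w); congruence].
    change (Re u = Re w).
    destruct (Rtotal_order (Re u) (Re w)) as [L'|[L'|L']]; [|exact L'|];
      apply M in L'; lra.
  - rewrite <- (Cconj_conj u), <- (Cconj_conj w). f_equal.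
    assert (E' : zexp (Cconj u) = zexp (Cconj w)) by (rewrite !zexp_conj, E; reflexivity).
    assert (Q : 0 < Im (zexp (Cconj w))) by (rewrite zexp_conj, Cconj_Im; lra).
    assert (Qu : 0 < Im (zexp (Cconj u))) by (rewrite E'; exact Q).
    exact (zexp_inj_upper _ _ (Omega_upper _ (Omega_conj u Hu) Qu)
      (Omega_upper _ (Omega_conj w Hw) Q) Qu E').
Qed.

(** * Values and derivative of the principal branch *)

Lemma Cder_holo (f : C -> C) (c d l : C) (t : R) :
  @is_derive C_AbsRing C_NormedModule f (c + RtoC t * d)%C l ->
  Cder (fun s => f (c + RtoC s * d)%C) t (l * d)%C.
Proof.
  intros [_ H].
  set (x := (c + RtoC t * d)%C) in *.
  assert (K : forall e, 0 < e -> exists del, 0 < del /\ forall k, k <> 0 -> Rabs k < del ->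
     Cmod ((f (c + RtoC (t + k) * d) - f x) / RtoC k - l * d)%C < e).
  { intros e He.
    assert (He' : 0 < e / (Cmod d + 1)).
    { apply Rdiv_lt_0_compat; [lra|]. pose proof (Cmod_ge_0 d); lra. }
    specialize (H x (fun P HP => HP) (mkposreal _ He')). simpl in H.
    assert (L : locally (T := R_UniformSpace) t (fun s : R =>
       Cmod (f (c + RtoC s * d) - f x - (c + RtoC s * d - x) * l)%C
         <= e / (Cmod d + 1) * Cmod (c + RtoC s * d - x)%C)).
    { apply locally_C in H.
      assert (Cq : Ccont (fun s : R => c + RtoC s * d)%C t).
      { apply Ccont_plus; [apply Ccont_const|]. apply Ccont_mult; [|apply Ccont_const].
        apply Ccont_RtoC, continuous_id. }
      apply Ccont_continuous in Cq. exact (Cq _ H). }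
    destruct L as [del Hd]. exists del. split; [destruct del; auto|].
    intros k Hk0 Hk.
    assert (Hb : ball t del (t + k)).
    { change (Rabs (t + k - t) < del). replace (t + k - t) with k by ring. exact Hk. }
    specialize (Hd (t + k) Hb).
    assert (E : (c + RtoC (t + k) * d - x = RtoC k * d)%C)
      by (unfold x; rewrite RtoC_plus; ring).
    rewrite E in Hd.
    assert (Hk' : RtoC k <> 0%C) by (intros Z; apply Hk0, (f_equal Re Z)).
    replace ((f (c + RtoC (t + k) * d) - f x) / RtoC k - l * d)%C
      with ((f (c + RtoC (t + k) * d) - f x - (RtoC k * d) * l) / RtoC k)%C by (field; exact Hk').
    rewrite Cmod_div by exact Hk'.
    rewrite Cmod_mult, Cmod_R in Hd. rewrite Cmod_R.
    pose proof (Rabs_pos_lt k Hk0) as Pk. pose proof (Cmod_ge_0 d) as Pd.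
    apply Rlt_div_l; [exact Pk|]. eapply Rle_lt_trans; [exact Hd|].
    replace (e / (Cmod d + 1) * (Rabs k * Cmod d))
      with (e * Rabs k * (Cmod d / (Cmod d + 1))) by (field; lra).
    rewrite <- (Rmult_1_r (e * Rabs k)) at 2. apply Rmult_lt_compat_l.
    - apply Rmult_lt_0_compat; lra.
    - apply Rlt_div_l; lra. }
  split; apply is_derive_Reals; intros e He; destruct (K e He) as (del & Hdel & Hd);
    exists (mkposreal _ Hdel); intros k Hk0 Hk; specialize (Hd k Hk0 Hk); fold x.
  - eapply Rle_lt_trans; [|exact Hd]. eapply Rle_trans; [|apply re_le_Cmod].
    right; f_equal. unfold Re, Im. simpl. field. exact Hk0.
  - eapply Rle_lt_trans; [|exact Hd]. eapply Rle_trans; [|apply im_le_Cmod].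
    right; f_equal. unfold Re, Im. simpl. field. exact Hk0.
Qed.


Lemma cut_plane_0_inv_e z : cut_plane 0 z -> cut_plane (- / exp 1) z.
Proof.
  intros H [H1 H2]; apply H; split; [exact H1|].
  pose proof (Rinv_0_lt_compat _ (exp_pos 1)); lra.
Qed.

Lemma cut_plane_line a z d : cut_plane a z ->
  locally (T := R_UniformSpace) 0 (fun s : R => cut_plane a (z + RtoC s * d)%C).
Proof.
  intros H. unfold cut_plane in *.
  assert (c1 : continuous (fun s : R => Im (z + RtoC s * d)%C) 0 /\
               continuous (fun s : R => Re (z + RtoC s * d)%C) 0).
  { assert (Cq : Ccont (fun s : R => z + RtoC s * d)%C 0).
    { apply Ccont_plus; [apply Ccont_const|]. apply Ccont_mult; [|apply Ccont_const].
      apply Ccont_RtoC, continuous_id. }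
    destruct Cq; split; assumption. }
  destruct c1 as [cI cR].
  assert (E0 : (z + RtoC 0 * d)%C = z) by ring.
  destruct (Req_dec (Im z) 0) as [E|N].
  - assert (Ha : a < Re z) by (apply Rnot_le_lt; intros K; apply H; auto).
    rewrite <- E0 in Ha.
    generalize (cR _ (open_gt a _ Ha)). unfold filtermap. apply filter_imp. intros s Hs [_ K]. lra.
  - rewrite <- E0 in N.
    generalize (cI _ (open_neq 0 _ N)). unfold filtermap. apply filter_imp. intros s Hs [K _]. apply Hs; exact K.
Qed.

Lemma Lambert_zexp W z : is_LambertW W -> cut_plane (- / exp 1) z -> zexp (W z) = z.
Proof. intros hW; apply hW. Qed.

Lemma Lambert_line W z d : is_LambertW W -> cut_plane (- / exp 1) z ->
  Cder (fun s => W (z + RtoC s * d)%C) 0 (C_derive W z * d)%C.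
Proof.
  intros hW Hz. apply Cder_holo. replace (z + RtoC 0 * d)%C with z by ring.
  apply C_derive_correct; [exact z|]. apply hW; exact Hz.
Qed.

(** Chain rule in E(W(z)) = z.  In particular E' does not vanish at W(z). *)
Lemma Lambert_derive W z : is_LambertW W -> cut_plane (- / exp 1) z ->
  (zexp' (W z) * C_derive W z = 1)%C.
Proof.
  intros hW Hz. pose proof (Cder_zexp _ _ _ (Lambert_line W z 1 hW Hz)) as H1.
  assert (H2 : Cder (fun s => zexp (W (z + RtoC s * 1)%C)) 0 1%C).
  { apply (Cder_ext_loc (fun s => z + RtoC s * 1)%C).
    - generalize (cut_plane_line _ z 1 Hz). apply filter_imp.
      intros s Hs. symmetry; apply Lambert_zexp; [exact hW | exact Hs].
    - eapply Cder_eq.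
      + apply Cder_plus; [apply Cder_const|].
        apply Cder_mult; [apply Cder_RtoC, is_derive_id | apply Cder_const].
      + unfold one; simpl; ring. }
  pose proof (Cder_unique _ _ _ _ H1 H2) as E. simpl in E.
  replace (z + 0 * 1)%C with z in E by ring. rewrite <- E. ring.
Qed.

Lemma IVT_cont (f : R -> R) a b v : a <= b ->
  (forall s, a <= s <= b -> continuous f s) -> f a <= v <= f b ->
  exists s, a <= s <= b /\ f s = v.
Proof.
  intros Hab Hc Hv.
  destruct (IVT_gen (fun x => f (clamp a b x)) a b v) as [s [Hs E]].
  - intros x. apply continuity_pt_filterlim.
    apply (continuous_comp (clamp a b) f); [apply clamp_cont; exact Hab|].
    apply Hc, clamp_in; exact Hab.
  - rewrite !clamp_id by lra. rewrite Rmin_left, Rmax_right; lra.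
  - rewrite Rmin_left, Rmax_right in Hs by lra.
    exists s. rewrite clamp_id in E; auto.
Qed.

(** A path x + i y in the plane starts on the real axis and E maps it to points of
    imaginary part s m > 0.  It moves upwards at first, and can meet neither the real
    axis, where E is real, nor the line y = PI, where Im E < 0. *)
Lemma strip_path (x y : R -> R) m : 0 < m ->
  (forall s, 0 <= s <= 1 -> continuous y s) -> y 0 = 0 -> is_derive y 0 m ->
  (forall s, 0 <= s <= 1 -> exp (x s) * (x s * sin (y s) + y s * cos (y s)) = s * m) ->
  0 < y 1 < PI.
Proof.
  intros Hm Hc H0 Hd HE.
  assert (nz : forall s, 0 < s <= 1 -> y s <> 0).
  { intros s Hs E. specialize (HE s ltac:(lra)). rewrite E, sin_0 in HE. nra. }
  assert (npi : forall s, 0 <= s <= 1 -> y s <> PI).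
  { intros s Hs E. specialize (HE s Hs). rewrite E, sin_PI, cos_PI in HE.
    pose proof (exp_pos (x s)). pose proof PI_RGT_0.
    assert (0 < exp (x s) * PI) by (apply Rmult_lt_0_compat; assumption). nra. }
  assert (small : exists s, 0 < s <= 1 /\ 0 < y s).
  { apply is_derive_Reals in Hd. destruct (Hd m Hm) as [d Hdd].
    assert (P : 0 < Rmin (d / 2) 1) by (apply Rmin_pos; [destruct d; simpl; lra | lra]).
    exists (Rmin (d / 2) 1). split; [split; [exact P | apply Rmin_r]|].
    specialize (Hdd (Rmin (d / 2) 1) ltac:(lra)).
    rewrite Rplus_0_l, H0, Rminus_0_r, (Rabs_pos_eq (Rmin _ _)) in Hdd by lra.
    specialize (Hdd ltac:(eapply Rle_lt_trans; [apply Rmin_l | destruct d; simpl; lra])).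
    apply Rabs_lt_between in Hdd. destruct Hdd as [Hdd _].
    assert (Q : 0 < y (Rmin (d / 2) 1) / Rmin (d / 2) 1) by lra.
    apply Rmult_lt_compat_r with (r := Rmin (d / 2) 1) in Q; [|exact P].
    rewrite Rmult_0_l in Q. unfold Rdiv at 1 in Q.
    rewrite Rmult_assoc, Rinv_l, Rmult_1_r in Q by lra. exact Q. }
  destruct small as [s [Hs Hys]].
  split.
  - apply Rnot_le_lt. intros K.
    destruct (IVT_cont (fun t => - y t) s 1 0) as [t [Ht E]].
    + lra.
    + intros t Ht. apply (Rcont_opp y), Hc; lra.
    + lra.
    + apply (nz t); lra.
  - apply Rnot_le_lt. intros K.
    destruct (IVT_cont y 0 1 PI) as [t [Ht E]].
    + lra.
    + exact Hc.
    + pose proof PI_RGT_0; lra.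
    + apply (npi t); assumption.
Qed.

(** Follow W along the segment from 0 to z.  For z off the real axis [strip_path]
    (up to conjugation) puts W(z) in the half of the strip |Im u| < PI on the side
    of z, and the sign of Im z then gives the inequality of Omega.  For z > 0 the path cannot meet
    |Im u| = PI, where E takes values off the positive axis, and [zexp_real]
    concludes. *)
Lemma Lambert_Omega W z : is_LambertW W -> cut_plane 0 z -> Omega (W z).
Proof.
  intros hW Hz.
  set (q := fun s => W (RtoC s * z)%C).
  assert (Hcut : forall s, 0 <= s <= 1 -> cut_plane (- / exp 1) (RtoC s * z)%C).
  { intros s Hs [H1 H2]. pose proof (Rinv_0_lt_compat _ (exp_pos 1)) as P.
    rewrite im_scal_l in H1. rewrite re_scal_l in H2.
    apply Rmult_integral in H1. destruct H1 as [H1|H1].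
    - rewrite H1 in H2. lra.
    - apply Hz. split; [exact H1|]. apply Rnot_lt_le. intros K. nra. }
  assert (Hq : forall s, 0 <= s <= 1 -> zexp (q s) = (RtoC s * z)%C).
  { intros s Hs. apply Lambert_zexp; [exact hW | apply Hcut, Hs]. }
  assert (Hd : forall s, 0 <= s <= 1 -> exists l, Cder q s l).
  { intros s Hs. destruct (proj1 hW _ (Hcut s Hs)) as [l Hl].
    exists (l * z)%C.
    apply (Cder_ext_loc (fun s => W (0 + RtoC s * z)%C)).
    - apply filter_forall. intros t. unfold q. f_equal. ring.
    - apply Cder_holo. replace (0 + RtoC s * z)%C with (RtoC s * z)%C by ring. exact Hl. }
  assert (Hc : forall s, 0 <= s <= 1 -> Ccont q s).
  { intros s Hs. destruct (Hd s Hs) as [l Hl]. exact (Cder_cont _ _ _ Hl). }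
  assert (q0 : q 0 = 0%C).
  { unfold q. rewrite Cmult_0_l. apply hW. }
  assert (dq0 : Cder q 0 z).
  { destruct (Hd 0 ltac:(lra)) as [l Hl].
    pose proof (Lambert_derive W 0 hW) as D.
    assert (H0 : cut_plane (- / exp 1) 0%C).
    { pose proof (Hcut 0 ltac:(lra)) as K. rewrite Cmult_0_l in K. exact K. }
    specialize (D H0).
    replace (W 0) with (RtoC 0) in D by (symmetry; apply hW).
    assert (E0 : zexp' 0 = 1%C).
    { unfold zexp', Cexp; simpl. rewrite exp_0, cos_0, sin_0.
      apply injective_projections; simpl; ring. }
    rewrite E0, Cmult_1_l in D.
    pose proof (Lambert_line W 0 z hW H0) as L. rewrite D, Cmult_1_l in L.
    apply (Cder_ext_loc (fun s => W (0 + RtoC s * z)%C)); [|exact L].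
    apply filter_forall. intros t. unfold q. f_equal. ring. }
  assert (q1 : q 1 = W z) by (unfold q; rewrite Cmult_1_l; reflexivity).
  assert (upper : 0 < Im (W z) < PI -> 0 < Im (zexp (W z)) -> Omega (W z)).
  { intros Hy Hi. rewrite Im_zexp in Hi.
    assert (Hs : 0 < sin (Im (W z))) by (apply sin_gt_0; lra).
    assert (Hp : 0 < Re (W z) * sin (Im (W z)) + Im (W z) * cos (Im (W z))).
    { pose proof (exp_pos (Re (W z))). apply Rnot_le_lt; intros K. nra. }
    pose proof (y_cos_lt_sin (Im (W z)) (proj1 Hy) (proj2 Hy)).
    split; [lra|]. split; [nra|].
    replace (_ + _) with (sin (Im (W z)) * (Re (W z) * sin (Im (W z)) + Im (W z) * cos (Im (W z))))
      by ring.
    apply Rmult_le_pos; lra. }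
  assert (lower : - PI < Im (W z) < 0 -> Im (zexp (W z)) < 0 -> Omega (W z)).
  { intros Hy Hi. rewrite Im_zexp in Hi.
    assert (Hs : sin (Im (W z)) < 0) by (apply sin_lt_0_var; lra).
    assert (Hp : Re (W z) * sin (Im (W z)) + Im (W z) * cos (Im (W z)) < 0).
    { pose proof (exp_pos (Re (W z))). apply Rnot_le_lt; intros K. nra. }
    pose proof (y_cos_lt_sin (- Im (W z)) ltac:(lra) ltac:(lra)) as T.
    rewrite cos_neg, sin_neg in T.
    split; [lra|]. split; [nra|].
    replace (_ + _) with ((- sin (Im (W z))) * - (Re (W z) * sin (Im (W z)) + Im (W z) * cos (Im (W z))))
      by ring.
    apply Rmult_le_pos; lra. }
  assert (Ez : zexp (W z) = z) by (apply Lambert_zexp; [exact hW | apply cut_plane_0_inv_e, Hz]).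
  assert (HI : forall s, 0 <= s <= 1 ->
     exp (Re (q s)) * (Re (q s) * sin (Im (q s)) + Im (q s) * cos (Im (q s))) = s * Im z).
  { intros s Hs. rewrite <- Im_zexp, Hq by exact Hs. apply im_scal_l. }
  destruct (Rtotal_order 0 (Im z)) as [L|[L|L]].
  - apply upper; [|rewrite Ez; exact L]. rewrite <- q1.
    apply (strip_path (fun s => Re (q s)) (fun s => Im (q s)) (Im z) L).
    + intros s Hs; apply (Hc s Hs).
    + rewrite q0; reflexivity.
    + apply dq0.
    + exact HI.
  - assert (Hr : 0 < Re z) by (apply Rnot_le_lt; intros K; apply Hz; split; auto).
    assert (Him : forall s, 0 <= s <= 1 -> Rabs (Im (q s)) <> PI).
    { intros s Hs E. pose proof (HI s Hs) as K. rewrite <- L, Rmult_0_r in K.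
      pose proof (exp_pos (Re (q s))). pose proof PI_RGT_0.
      apply Rmult_integral in K. destruct K as [K|K]; [lra|].
      unfold Rabs in E. destruct Rcase_abs.
      - replace (Im (q s)) with (- PI) in K by lra.
        rewrite sin_neg, cos_neg, sin_PI, cos_PI in K. lra.
      - rewrite E, sin_PI, cos_PI in K. lra. }
    assert (Hb : Rabs (Im (W z)) < PI).
    { apply Rnot_le_lt. intros K. rewrite <- q1 in K.
      destruct (IVT_cont (fun s => Rabs (Im (q s))) 0 1 PI) as [t [Ht E]].
      - lra.
      - intros s Hs. apply (continuous_comp (fun s => Im (q s)) Rabs).
        + apply (Hc s Hs).
        + apply (continuous_Rabs (Im (q s))).
      - rewrite q0; simpl. rewrite Rabs_R0. pose proof PI_RGT_0; lra.
      - apply (Him t Ht E). }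
    apply Rabs_lt_between in Hb.
    destruct (zexp_real (W z) Hb) as [K1 K2]; [rewrite Ez; auto | rewrite Ez; exact Hr|].
    unfold Omega. rewrite K1, sin_0. split; [|split; lra]. pose proof PI_RGT_0; lra.
  - apply lower; [|rewrite Ez; exact L].
    assert (K : 0 < - Im (W z) < PI); [|lra].
    rewrite <- q1.
    apply (strip_path (fun s => Re (q s)) (fun s => - Im (q s)) (- Im z)).
    + lra.
    + intros s Hs; apply Rcont_opp, (Hc s Hs).
    + rewrite q0; simpl; ring.
    + apply (is_derive_opp (V := R_NormedModule)), dq0.
    + intros s Hs. rewrite sin_neg, cos_neg.
      transitivity (- (s * Im z)); [rewrite <- HI by exact Hs|]; ring.
Qed.

(** * Complex integrals and angle functions *)

Definition CIntable (f : R -> C) (a b : R) : Prop :=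
  ex_RInt (fun t => Re (f t)) a b /\ ex_RInt (fun t => Im (f t)) a b.

Lemma CIntable_cont f a b : a <= b -> (forall t, a <= t <= b -> Ccont f t) -> CIntable f a b.
Proof.
  intros Hab H; split; apply (ex_RInt_continuous (V := R_CompleteNormedModule));
    rewrite Rmin_left, Rmax_right by exact Hab; intros t Ht; apply (H t Ht).
Qed.

Lemma CInt_ext f g a b : a <= b -> (forall t, a < t < b -> f t = g t) -> CInt f a b = CInt g a b.
Proof.
  intros Hab H; unfold CInt; f_equal; apply RInt_ext;
    rewrite Rmin_left, Rmax_right by exact Hab; intros t Ht; rewrite H by exact Ht; reflexivity.
Qed.

Lemma CInt_minus f g a b : CIntable f a b -> CIntable g a b ->
  CInt (fun t => f t - g t)%C a b = (CInt f a b - CInt g a b)%C.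
Proof.
  intros [H1 H2] [H3 H4].
  apply injective_projections;
    [exact (RInt_minus (V := R_CompleteNormedModule) _ _ a b H1 H3)
    |exact (RInt_minus (V := R_CompleteNormedModule) _ _ a b H2 H4)].
Qed.

Lemma CInt_scal c f a b : CIntable f a b ->
  CInt (fun t => c * f t)%C a b = (c * CInt f a b)%C.
Proof.
  intros [H1 H2].
  assert (S : forall (k : R) g, ex_RInt g a b -> ex_RInt (fun t => k * g t) a b)
    by (intros k g; apply (ex_RInt_scal (V := R_NormedModule))).
  assert (S' : forall (k : R) g, ex_RInt g a b -> RInt (fun t => k * g t) a b = k * RInt g a b)
    by (intros k g; apply (RInt_scal (V := R_CompleteNormedModule))).
  apply injective_projections; unfold CInt, Re, Im in *; simpl.
  - rewrite <- !S' by assumption.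
    apply (RInt_minus (V := R_CompleteNormedModule)); apply S; assumption.
  - rewrite <- !S' by assumption.
    apply (RInt_plus (V := R_CompleteNormedModule)); apply S; assumption.
Qed.

Lemma CInt_bound f a b M : a <= b -> CIntable f a b ->
  (forall t, a <= t <= b -> Cmod (f t) <= M) -> Cmod (CInt f a b) <= 2 * ((b - a) * M).
Proof.
  intros Hab [H1 H2] HM. eapply Rle_trans; [apply Cmod_le_sum|].
  assert (B1 : Rabs (Re (CInt f a b)) <= (b - a) * M).
  { apply abs_RInt_le_const; [exact Hab | exact H1 |].
    intros t Ht; eapply Rle_trans; [apply re_le_Cmod | auto]. }
  assert (B2 : Rabs (Im (CInt f a b)) <= (b - a) * M).
  { apply abs_RInt_le_const; [exact Hab | exact H2 |].
    intros t Ht; eapply Rle_trans; [apply im_le_Cmod | auto]. }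
  lra.
Qed.

(** An argument of u that is continuous off the half-line [0, +oo): it is
    arg (-u), with values in (-PI, PI), by the half-angle formula. *)
Definition slit_angle (u : C) : R :=
  2 * atan (- Im u / (- Re u + sqrt (Re u ^ 2 + Im u ^ 2))).

Lemma slit_pos u : cut_plane 0 (- u)%C -> 0 < - Re u + sqrt (Re u ^ 2 + Im u ^ 2) /\
  0 < Re u ^ 2 + Im u ^ 2.
Proof.
  unfold cut_plane. change (Re (- u)) with (- Re u). change (Im (- u)) with (- Im u).
  intros H.
  assert (P : 0 < Re u ^ 2 + Im u ^ 2).
  { destruct (Req_dec (Im u) 0) as [E|N]; [|nra].
    destruct (Req_dec (Re u) 0) as [E'|N']; [|nra]. exfalso; apply H; lra. }
  split; [|exact P].
  pose proof (sqrt_pos (Re u ^ 2 + Im u ^ 2)) as S0.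
  pose proof (sqrt_sqrt (Re u ^ 2 + Im u ^ 2) ltac:(lra)) as S1.
  destruct (Req_dec (Im u) 0) as [E|N].
  - assert (- Re u > 0) by (apply Rnot_le_gt; intros K; apply H; split; lra). lra.
  - apply Rnot_le_lt; intros K.
    assert (0 <= sqrt (Re u ^ 2 + Im u ^ 2) <= Re u) by lra. nra.
Qed.

(** The algebra behind [arg_der].  With k = x + r and v = y / k, the relation
    r^2 = x^2 + y^2 parametrizes rationally as x = k (1 - v^2) / 2,
    r = k (1 + v^2) / 2. *)
Lemma half_angle_algebra x y r x' y' : 0 < x + r -> 0 < r -> r * r = x * x + y * y ->
  2 * (((y' * (x + r) - y * (x' + (x * x' + y * y') / r)) / (x + r) ^ 2)
       / (1 + (y / (x + r)) ^ 2)) = (x * y' - y * x') / (x * x + y * y).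
Proof.
  intros Hk Hr0 Hr.
  set (k := x + r) in *. set (v := y / k).
  assert (Ey : y = v * k) by (unfold v; field; lra).
  assert (Er : r = k - x) by (unfold k; ring).
  assert (Ex : x = k * (1 - v ^ 2) / 2).
  { assert (k * x * 2 = k * (k * (1 - v ^ 2))).
    { replace (k * (k * (1 - v ^ 2))) with (k * k - (v * k) * (v * k)) by ring.
      rewrite <- Ey. rewrite Er in Hr. lra. }
    apply Rmult_eq_reg_l with (2 * k); [|lra]. field_simplify. lra. }
  assert (Er' : r = k * (1 + v ^ 2) / 2) by (rewrite Er, Ex at 1; field).
  clearbody k v. rewrite Er', Ey, Ex.
  pose proof (pow2_ge_0 v) as Pv.
  field. repeat split; nra.
Qed.

Lemma arg_der (x y : R -> R) t x' y' : is_derive x t x' -> is_derive y t y' ->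
  0 < x t + sqrt (x t ^ 2 + y t ^ 2) -> 0 < x t ^ 2 + y t ^ 2 ->
  is_derive (fun s => 2 * atan (y s / (x s + sqrt (x s ^ 2 + y s ^ 2)))) t
    ((x t * y' - y t * x') / (x t * x t + y t * y t)).
Proof.
  intros H1 H2 P1 P2.
  pose proof (is_derive_unique _ _ _ H1) as E1. pose proof (is_derive_unique _ _ _ H2) as E2.
  assert (Hr : sqrt (x t ^ 2 + y t ^ 2) * sqrt (x t ^ 2 + y t ^ 2) = x t * x t + y t * y t).
  { rewrite sqrt_sqrt; lra. }
  assert (Hr0 : 0 < sqrt (x t ^ 2 + y t ^ 2)) by (apply sqrt_lt_R0; exact P2).
  rewrite <- (half_angle_algebra _ _ _ x' y' P1 Hr0 Hr).
  evar_last.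
  - apply (is_derive_scal (fun s => atan (y s / (x s + sqrt (x s ^ 2 + y s ^ 2))))).
    apply (is_derive_comp atan (fun s => y s / (x s + sqrt (x s ^ 2 + y s ^ 2))));
      [apply is_derive_atan|].
    apply is_derive_div; [exact H2 | | lra].
    apply (is_derive_plus (V := R_NormedModule)); [exact H1|].
    apply (is_derive_sqrt (fun s => x s ^ 2 + y s ^ 2)); [|exact P2].
    apply (is_derive_plus (V := R_NormedModule)); apply is_derive_pow; eassumption.
  - unfold scal, plus; simpl; unfold mult; simpl. unfold Rsqr.
    set (r := sqrt (x t * (x t * 1) + y t * (y t * 1))).
    change (sqrt (x t ^ 2 + y t ^ 2)) with r in P1, Hr0.
    field. simpl in P2. repeat split; try lra; nra.
Qed.

Lemma slit_angle_der q t l : Cder q t l -> cut_plane 0 (- q t)%C ->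
  is_derive (fun s => slit_angle (q s)) t (Im (l / q t)%C).
Proof.
  intros [H1 H2] Hs. destruct (slit_pos _ Hs) as [P1 P2].
  assert (Sq : forall a, (- a) ^ 2 = a ^ 2) by (intros; ring).
  evar_last.
  - apply (is_derive_ext (fun s => 2 * atan (- Im (q s) /
      (- Re (q s) + sqrt ((- Re (q s)) ^ 2 + (- Im (q s)) ^ 2))))).
    + intros s; unfold slit_angle; rewrite !Sq; reflexivity.
    + apply (arg_der (fun s => - Re (q s)) (fun s => - Im (q s))).
      * apply (is_derive_opp (V := R_NormedModule)); exact H1.
      * apply (is_derive_opp (V := R_NormedModule)); exact H2.
      * cbv beta; rewrite !Sq; exact P1.
      * cbv beta; rewrite !Sq; exact P2.
  - unfold opp, Re, Im in *; simpl in *. field. lra.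
Qed.

Lemma atan_angle_der q t l : Cder q t l -> 0 < Re (q t) ->
  is_derive (fun s => atan (Im (q s) / Re (q s))) t (Im (l / q t)%C).
Proof.
  intros [H1 H2] P. evar_last.
  - apply (is_derive_comp atan (fun s => Im (q s) / Re (q s))); [apply is_derive_atan|].
    apply is_derive_div; [exact H2 | exact H1 | lra].
  - unfold scal; simpl; unfold mult, Rsqr; unfold Re, Im in *; simpl. field.
    repeat split; nra.
Qed.

Lemma log_norm_der q t l : Cder q t l -> q t <> 0%C ->
  is_derive (fun s => ln (Re (q s) ^ 2 + Im (q s) ^ 2) / 2) t (Re (l / q t)%C).
Proof.
  intros [H1 H2] P. apply C_sqnorm_neq0 in P.
  assert (P' : 0 < Re (q t) ^ 2 + Im (q t) ^ 2) by (unfold Re, Im in *; nra).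
  evar_last.
  - apply (is_derive_ext (fun s => / 2 * ln (Re (q s) ^ 2 + Im (q s) ^ 2)));
      [intros; apply Rmult_comm|].
    apply (is_derive_scal (fun s => ln (Re (q s) ^ 2 + Im (q s) ^ 2))).
    apply (is_derive_comp ln (fun s => Re (q s) ^ 2 + Im (q s) ^ 2));
      [apply is_derive_ln; exact P'|].
    apply (is_derive_plus (V := R_NormedModule)); apply is_derive_pow; eassumption.
  - unfold scal, plus; simpl; unfold mult; unfold Re, Im in *; simpl in *. field. lra.
Qed.

(** The two arguments arg (-u) and arg u differ by PI in the first quadrant; this and
    its mirror image produce the winding number. *)
Lemma slit_angle_jump u : 0 < Re u -> 0 < Im u ->
  slit_angle u = atan (Im u / Re u) - PI.
Proof.
  intros Hx Hy. unfold slit_angle.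
  set (x := Re u) in *. set (y := Im u) in *. set (r := sqrt (x ^ 2 + y ^ 2)).
  assert (Hr : r * r = x * x + y * y) by (unfold r; rewrite sqrt_sqrt; nra).
  assert (Hr0 : 0 < r) by (apply sqrt_lt_R0; nra).
  assert (Hrx : x < r) by nra.
  assert (Hb : 0 < atan (y / x) < PI / 2).
  { split; [|apply atan_bound].
    rewrite <- atan_0. apply atan_increasing. apply Rdiv_lt_0_compat; assumption. }
  set (b := atan (y / x)) in *.
  assert (Tb : tan b = y / x) by apply tan_atan.
  assert (Cb : 0 < cos b) by (apply cos_gt_0; lra).
  assert (Sb : 0 < sin b) by (apply sin_gt_0; lra).
  assert (S2 : sin b * x = y * cos b).
  { unfold tan in Tb. apply Rmult_eq_reg_r with (/ (cos b * x)).
    - transitivity (sin b / cos b); [field; lra|]. rewrite Tb; field; lra.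
    - apply Rinv_neq_0_compat; nra. }
  pose proof (sin2_cos2 b) as T; unfold Rsqr in T.
  assert (Xr : x = r * cos b).
  { apply Rsqr_inj; [lra | nra |]. unfold Rsqr.
    transitivity ((x * cos b) * (x * cos b) + (sin b * x) * (sin b * x)).
    - rewrite <- (Rmult_1_r (x * x)), <- T; ring.
    - rewrite S2. transitivity ((r * r) * (cos b * cos b)); [rewrite Hr|]; ring. }
  assert (Yr : y = r * sin b).
  { apply Rmult_eq_reg_r with (cos b); [|lra]. rewrite <- S2, Xr at 1. ring. }
  assert (E : - y / (- x + r) = tan (b / 2 - PI / 2)).
  { assert (C2 : cos b = 1 - 2 * sin (b / 2) * sin (b / 2)).
    { rewrite <- cos_2a_sin. f_equal; field. }
    assert (S2' : sin b = 2 * sin (b / 2) * cos (b / 2)).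
    { rewrite <- sin_2a. f_equal; field. }
    assert (P2 : 0 < sin (b / 2)) by (apply sin_gt_0; lra).
    replace (b / 2 - PI / 2) with (- (PI / 2 - b / 2)) by ring.
    unfold tan. rewrite sin_neg, cos_neg, sin_shift, cos_shift.
    rewrite Xr, Yr, C2, S2'. field. repeat split; nra. }
  rewrite E. assert (A : atan (tan (b / 2 - PI / 2)) = b / 2 - PI / 2).
  { apply atan_tan. lra. }
  rewrite A. field.
Qed.

Lemma slit_angle_conj u : slit_angle (Cconj u) = - slit_angle u.
Proof.
  unfold slit_angle. rewrite Cconj_Re, Cconj_Im.
  replace ((- Im u) ^ 2) with (Im u ^ 2) by ring.
  replace (- - Im u / (- Re u + sqrt (Re u ^ 2 + Im u ^ 2)))
    with (- (- Im u / (- Re u + sqrt (Re u ^ 2 + Im u ^ 2)))) by (unfold Rdiv; ring).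
  rewrite atan_opp. ring.
Qed.

(** * The contour integral *)

(** The upper half of the boundary curve of Omega. *)
Definition edge (v : R) : C := (edge_x v, v).
Definition edge' (v : R) : C := (edge_x' v, 1).
Definition vert (x y : R) : C := (x, y).

Definition weight (v : R) : R := v * csc v * exp (- v * cot v).

(** E folds the boundary curve onto the cut. *)
Lemma zexp_edge v : 0 < v < PI -> zexp (edge v) = RtoC (- weight v).
Proof.
  intros Hv. assert (Hs : 0 < sin v) by (apply sin_gt_0; lra).
  assert (Eb : edge_x v = - v * cot v) by (unfold edge_x, cot; field; lra).
  apply injective_projections.
  - change (Re (zexp (edge v)) = - weight v). rewrite Re_zexp.
    change (Re (edge v)) with (edge_x v). change (Im (edge v)) with v.
    unfold weight. rewrite <- Eb.
    pose proof (sin2_cos2 v) as T; unfold Rsqr in T.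
    replace (edge_x v * cos v - v * sin v) with (- (v * csc v)); [ring|].
    unfold edge_x, csc. rewrite <- (Rmult_1_r v) at 1. rewrite <- T at 1. field. lra.
  - change (Im (zexp (edge v)) = 0). rewrite Im_zexp.
    change (Re (edge v)) with (edge_x v). change (Im (edge v)) with v.
    unfold edge_x. field. lra.
Qed.

Lemma weight_pos v : 0 < v < PI -> 0 < weight v.
Proof.
  intros Hv. assert (Hs : 0 < sin v) by (apply sin_gt_0; lra).
  unfold weight, csc. repeat apply Rmult_lt_0_compat; try lra.
  - apply Rinv_0_lt_compat; lra.
  - apply exp_pos.
Qed.

Lemma Omega_edge v : 0 < v < PI -> Omega (edge v).
Proof.
  intros Hv. assert (Hs : 0 < sin v) by (apply sin_gt_0; lra).
  pose proof (y_cos_lt_sin v (proj1 Hv) (proj2 Hv)) as K.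
  unfold Omega, edge, Re, Im; simpl. split; [lra|]. split.
  - unfold edge_x. apply Rle_div_r; [exact Hs | lra].
  - right. unfold edge_x. field. lra.
Qed.

(** A vertical chord between conjugate boundary points, inside Omega by convexity. *)
Lemma Omega_vert v y : 0 < v < PI -> - v <= y <= v -> Omega (vert (edge_x v) y).
Proof.
  intros Hv Hy.
  replace (vert (edge_x v) y) with (contract (Cconj (edge v)) ((y + v) / (2 * v)) (edge v)).
  - apply Omega_convex; [apply Omega_conj | |]; try apply Omega_edge; try exact Hv.
    split; [apply Rle_div_r; lra | apply Rle_div_l; lra].
  - unfold contract, vert, edge. apply injective_projections; simpl; field; lra.
Qed.

Lemma edge_der v : 0 < v < PI -> Cder edge v (edge' v).
Proof.
  intros Hv. assert (Hs : 0 < sin v) by (apply sin_gt_0; lra). split.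
  - apply edge_x_der; lra.
  - apply (is_derive_id (K := R_AbsRing)).
Qed.

Lemma edge'_cont v : 0 < v < PI -> Ccont edge' v.
Proof.
  intros Hv. assert (Hs : 0 < sin v) by (apply sin_gt_0; lra). split.
  - apply (ex_derive_continuous (V := R_NormedModule)). eexists. apply edge_x'_der; lra.
  - apply continuous_const.
Qed.

Lemma Cder_conj f t l : Cder f t l -> Cder (fun s => Cconj (f s)) t (Cconj l).
Proof. intros [H1 H2]; split; [exact H1 | apply (is_derive_opp (V := R_NormedModule)); exact H2]. Qed.

Lemma Ccont_conj {T : UniformSpace} (f : T -> C) x : Ccont f x -> Ccont (fun s => Cconj (f s)) x.
Proof. intros [H1 H2]; split; [exact H1 | apply Rcont_opp; exact H2]. Qed.

Lemma vert_der x y : Cder (vert x) y Ci.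
Proof.
  split.
  - exact (is_derive_const (V := R_NormedModule) x y).
  - exact (is_derive_id (K := R_AbsRing) y).
Qed.

Definition winding_int (w : C) (p dp : R -> C) a b : C := CInt (fun v => dp v / (p v - w))%C a b.
Definition cauchy_int (w : C) (p dp : R -> C) a b : C :=
  CInt (fun v => dp v / (zexp (p v) - zexp w))%C a b.

Definition log_norm (u : C) : R := ln (Re u ^ 2 + Im u ^ 2) / 2.

Lemma winding_piece w p dp ang a b : a <= b ->
  (forall v, a <= v <= b -> p v <> w /\ Cder p v (dp v) /\ Ccont dp v /\
     is_derive (fun s => ang (p s - w)%C) v (Im (dp v / (p v - w))%C)) ->
  winding_int w p dp a b =
    (log_norm (p b - w)%C - log_norm (p a - w)%C, ang (p b - w)%C - ang (p a - w)%C).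
Proof.
  intros Hab H.
  assert (Hc : forall v, a <= v <= b -> Ccont (fun v => dp v / (p v - w))%C v).
  { intros v Hv. destruct (H v Hv) as (H1 & H2 & H3 & _). apply Ccont_div; [exact H3| |].
    - apply Ccont_minus; [exact (Cder_cont _ _ _ H2) | apply Ccont_const].
    - apply Cminus_eq_contra; exact H1. }
  unfold winding_int, CInt; f_equal; apply is_RInt_unique.
  - apply (is_RInt_derive (fun s => log_norm (p s - w)%C));
      rewrite Rmin_left, Rmax_right by exact Hab; intros v Hv.
    + destruct (H v Hv) as (H1 & H2 & H3 & _).
      apply (log_norm_der (fun s => p s - w)%C).
      * eapply Cder_eq; [apply Cder_minus; [exact H2 | apply Cder_const] | ring].
      * apply Cminus_eq_contra; exact H1.
    + exact (proj1 (Hc v Hv)).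
  - apply (is_RInt_derive (fun s => ang (p s - w)%C));
      rewrite Rmin_left, Rmax_right by exact Hab; intros v Hv.
    + apply (H v Hv).
    + exact (proj2 (Hc v Hv)).
Qed.

Lemma pullback_1 w p dp a b : a <= b ->
  (forall v, a <= v <= b -> p v <> w /\ zexp (p v) <> zexp w) ->
  CInt (pullback (invquot w) w p dp 1) a b = cauchy_int w p dp a b.
Proof.
  intros Hab H. apply CInt_ext; [exact Hab|]. intros v Hv.
  destruct (H v ltac:(lra)) as [H1 H2].
  unfold pullback. replace (contract w 1 (p v)) with (p v) by (unfold contract; ring).
  rewrite invquot_neq by exact H1. field. split; apply Cminus_eq_contra; assumption.
Qed.

Lemma pullback_0 w p dp a b : a <= b ->
  (forall v, a <= v <= b -> p v <> w /\ Cder p v (dp v) /\ Ccont dp v) ->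
  CInt (pullback (invquot w) w p dp 0) a b = (/ zexp' w * winding_int w p dp a b)%C.
Proof.
  intros Hab H. unfold winding_int. rewrite <- CInt_scal.
  - apply CInt_ext; [exact Hab|]. intros v Hv.
    unfold pullback. replace (contract w 0 (p v)) with w by (unfold contract; ring).
    rewrite invquot_at. reflexivity.
  - apply CIntable_cont; [exact Hab|]. intros v Hv.
    destruct (H v Hv) as (H1 & H2 & H3). apply Ccont_div; [exact H3| |].
    + apply Ccont_minus; [exact (Cder_cont _ _ _ H2) | apply Ccont_const].
    + apply Cminus_eq_contra; exact H1.
Qed.

Definition edge_conj (v : R) : C := Cconj (edge v).
Definition edge_conj' (v : R) : C := Cconj (edge' v).

(** The four arcs form a counterclockwise closed contour: right along the lower edge,
    up the right-hand chord, left along the upper edge, down the left-hand chord. *)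
Definition contour_sum (J : (R -> C) -> (R -> C) -> R -> R -> C) (e V : R) : C :=
  (J edge_conj edge_conj' e V + J (vert (edge_x V)) (fun _ => Ci) (- V)%R V
   - J edge edge' e V - J (vert (edge_x e)) (fun _ => Ci) (- e)%R e)%C.

Definition admissible_arc (w : C) (p dp : R -> C) (a b : R) : Prop :=
  forall v, a <= v <= b -> Omega (p v) /\ p v <> w /\ Cder p v (dp v) /\ Ccont dp v.

(** The end point rates of [star_piece] cancel over the four arcs, so the total at
    r = 1 equals the total at r = 0. *)
Lemma contour_deform w e V : Omega w -> cut_plane 0 (zexp w) -> zexp' w <> 0%C ->
  0 < e -> e < V ->
  admissible_arc w edge_conj edge_conj' e V -> admissible_arc w (vert (edge_x V)) (fun _ => Ci) (- V) V ->
  admissible_arc w edge edge' e V -> admissible_arc w (vert (edge_x e)) (fun _ => Ci) (- e) e ->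
  contour_sum (cauchy_int w) e V = (/ zexp' w * contour_sum (winding_int w) e V)%C.
Proof.
  intros Hw Hz Hw' He HV P1 P2 P3 P4.
  assert (St : star_holomorphic (invquot w) (invquot' w) w Omega).
  { apply invquot_star; [| |exact Hw'].
    - intros u r Hu Hr; apply Omega_convex; assumption.
    - intros u Hu E; apply zexp_inj_Omega; assumption. }
  assert (One : forall p dp a b, a <= b -> admissible_arc w p dp a b ->
     CInt (pullback (invquot w) w p dp 1) a b = cauchy_int w p dp a b).
  { intros p dp a b Hab P. apply pullback_1; [exact Hab|]. intros v Hv.
    destruct (P v Hv) as (H1 & H2 & _). split; [exact H2|].
    intros E; apply H2, zexp_inj_Omega; assumption. }
  assert (Zero : forall p dp a b, a <= b -> admissible_arc w p dp a b ->
     CInt (pullback (invquot w) w p dp 0) a b = (/ zexp' w * winding_int w p dp a b)%C).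
  { intros p dp a b Hab P. apply pullback_0; [exact Hab|]. intros v Hv. apply P; exact Hv. }
  pose proof (star_piece _ _ _ _ edge_conj edge_conj' e V St (Rlt_le _ _ HV) P1) as [R1 I1].
  pose proof (star_piece _ _ _ _ _ _ (- V) V St ltac:(lra) P2) as [R2 I2].
  pose proof (star_piece _ _ _ _ edge edge' e V St (Rlt_le _ _ HV) P3) as [R3 I3].
  pose proof (star_piece _ _ _ _ _ _ (- e) e St ltac:(lra) P4) as [R4 I4].
  set (Psi := fun r => contour_sum (fun p dp => CInt (pullback (invquot w) w p dp r)) e V).
  assert (E : Psi 0 = Psi 1).
  { apply injective_projections.
    - pose proof (unif_diff01_plus _ _ _ _ (unif_diff01_plus _ _ _ _ (unif_diff01_plus _ _ _ _ R1 R2)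
        (unif_diff01_opp _ _ R3)) (unif_diff01_opp _ _ R4)) as T.
      refine (unif_diff01_const _ _ T _).
      intros r Hr. change (vert (edge_x V) V) with (edge V). change (vert (edge_x e) e) with (edge e).
      change (vert (edge_x V) (- V)) with (edge_conj V). change (vert (edge_x e) (- e)) with (edge_conj e).
      unfold Cdiv. generalize (/ RtoC r)%C (invquot w (contract w r (edge V)))
        (invquot w (contract w r (edge e))) (invquot w (contract w r (edge_conj V)))
        (invquot w (contract w r (edge_conj e))).
      intros k a b c d. unfold Re; simpl. ring.
    - pose proof (unif_diff01_plus _ _ _ _ (unif_diff01_plus _ _ _ _ (unif_diff01_plus _ _ _ _ I1 I2)
        (unif_diff01_opp _ _ I3)) (unif_diff01_opp _ _ I4)) as T.
      refine (unif_diff01_const _ _ T _).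
      intros r Hr. change (vert (edge_x V) V) with (edge V). change (vert (edge_x e) e) with (edge e).
      change (vert (edge_x V) (- V)) with (edge_conj V). change (vert (edge_x e) (- e)) with (edge_conj e).
      unfold Cdiv. generalize (/ RtoC r)%C (invquot w (contract w r (edge V)))
        (invquot w (contract w r (edge e))) (invquot w (contract w r (edge_conj V)))
        (invquot w (contract w r (edge_conj e))).
      intros k a b c d. unfold Im; simpl. ring. }
  unfold Psi, contour_sum in E. rewrite !Zero, !One in E by (try assumption; lra).
  unfold contour_sum. rewrite <- E. ring.
Qed.

(** Seen from w, the two edges and the left segment avoid the half-line going right,
    so [slit_angle] is a continuous argument along them; on the right segment the
    arctangent is one.  The two end points where these arguments are exchanged each
    contribute PI, and the logarithms of the modulus cancel. *)
Lemma contour_winding w e V : Omega w -> 0 < e -> e < V -> V < PI ->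
  - V < Im w < V -> Re w < edge_x V -> (- e <= Im w <= e -> edge_x e < Re w) ->
  admissible_arc w edge_conj edge_conj' e V -> admissible_arc w (vert (edge_x V)) (fun _ => Ci) (- V) V ->
  admissible_arc w edge edge' e V -> admissible_arc w (vert (edge_x e)) (fun _ => Ci) (- e) e ->
  contour_sum (winding_int w) e V = (RtoC (2 * PI) * Ci)%C.
Proof.
  intros Hw He HeV HV Hi Hr Hl P1 P2 P3 P4.
  assert (Cm : forall p dp v, Cder p v (dp v) -> Cder (fun s => p s - w)%C v (dp v)).
  { intros p dp v H. eapply Cder_eq; [apply Cder_minus; [exact H | apply Cder_const] | ring]. }
  assert (S : forall p dp a b, a <= b -> admissible_arc w p dp a b ->
     (forall v, a <= v <= b -> cut_plane 0 (- (p v - w))%C) ->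
     winding_int w p dp a b = (log_norm (p b - w)%C - log_norm (p a - w)%C,
        slit_angle (p b - w)%C - slit_angle (p a - w)%C)).
  { intros p dp a b Hab P Hs. apply winding_piece; [exact Hab|]. intros v Hv.
    destruct (P v Hv) as (_ & H2 & H3 & H4). do 3 (split; [assumption|]).
    apply (slit_angle_der (fun s => p s - w)%C); [apply Cm; exact H3 | apply Hs; exact Hv]. }
  assert (cutw : forall u, (Im u = Im w -> Re u < Re w) -> cut_plane 0 (- (u - w))%C).
  { intros u H [K1 K2]. change (Im (- (u - w))%C) with (- (Im u - Im w)) in K1.
    change (Re (- (u - w))%C) with (- (Re u - Re w)) in K2. specialize (H ltac:(lra)). lra. }
  assert (left_of_w : forall v, e <= v <= V -> forall s, s = 1 \/ s = -1 -> s * v = Im w ->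
     (edge_x v, s * v) <> w -> edge_x v < Re w).
  { intros v Hv s Hs Es Hn. assert (Hsin : 0 < sin v) by (apply sin_gt_0; lra).
    assert (Hge : edge_x v <= Re w).
    { destruct Hw as (_ & _ & K). rewrite <- Es in K. unfold edge_x.
      apply Rle_div_l; [exact Hsin|].
      destruct Hs as [-> | ->].
      - rewrite Rmult_1_l in K. nra.
      - replace (-1 * v) with (- v) in K by ring. rewrite sin_neg, cos_neg in K. nra. }
    destruct Hge as [L|E]; [exact L|]. exfalso; apply Hn.
    apply injective_projections; [exact E | exact Es]. }
  unfold contour_sum.
  rewrite (S edge_conj edge_conj' e V); [| lra | exact P1 |].
  2:{ intros v Hv. apply cutw. intros E. change (Re (edge_conj v)) with (edge_x v).
      change (Im (edge_conj v)) with (- v) in E. apply (left_of_w v Hv (-1)); [auto | lra |].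
      destruct (P1 v Hv) as (_ & N & _). replace (-1 * v) with (- v) by ring. exact N. }
  rewrite (S edge edge' e V); [| lra | exact P3 |].
  2:{ intros v Hv. apply cutw. intros E. change (Re (edge v)) with (edge_x v).
      change (Im (edge v)) with v in E. apply (left_of_w v Hv 1); [auto | lra |].
      destruct (P3 v Hv) as (_ & N & _). rewrite Rmult_1_l. exact N. }
  rewrite (S (vert (edge_x e)) (fun _ => Ci) (- e) e); [| lra | exact P4 |].
  2:{ intros v Hv. apply cutw. change (Re (vert (edge_x e) v)) with (edge_x e).
      change (Im (vert (edge_x e) v)) with v. intros E; apply Hl; lra. }
  rewrite (winding_piece w (vert (edge_x V)) (fun _ => Ci) (fun u => atan (Im u / Re u)) (- V) V);
    [| lra |].
  2:{ intros v Hv. destruct (P2 v Hv) as (_ & H2 & H3 & H4). do 3 (split; [assumption|]).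
      apply (atan_angle_der (fun s => vert (edge_x V) s - w)%C).
      - apply (Cm _ (fun _ => Ci)); exact H3.
      - change (0 < edge_x V - Re w). lra. }
  change (vert (edge_x V) V) with (edge V). change (vert (edge_x e) e) with (edge e).
  change (vert (edge_x V) (- V)) with (edge_conj V). change (vert (edge_x e) (- e)) with (edge_conj e).
  assert (JT : slit_angle (edge V - w)%C
    = atan (Im (edge V - w)%C / Re (edge V - w)%C) - PI).
  { apply slit_angle_jump; [change (0 < edge_x V - Re w) | change (0 < V - Im w)]; lra. }
  assert (JB : slit_angle (edge_conj V - w)%C
    = atan (Im (edge_conj V - w)%C / Re (edge_conj V - w)%C) + PI).
  { pose proof (slit_angle_jump (Cconj (edge_conj V - w)%C)) as J.
    rewrite slit_angle_conj, Cconj_Re, Cconj_Im, Rdiv_opp_l, atan_opp in J.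
    change (Re (edge_conj V - w)%C) with (edge_x V - Re w) in *.
    change (Im (edge_conj V - w)%C) with (- V - Im w) in *.
    specialize (J ltac:(lra) ltac:(lra)). lra. }
  rewrite JT, JB.
  apply injective_projections; simpl; ring.
Qed.

(** * Integrability and the limit of the contour *)

Definition sinc (v : R) : R := if Req_EM_T v 0 then 1 else sin v / v.

Lemma sinc_0 : sinc 0 = 1.
Proof. unfold sinc; destruct Req_EM_T; [reflexivity | lra]. Qed.

Lemma sinc_neq v : v <> 0 -> sinc v = sin v / v.
Proof. intros H; unfold sinc; destruct Req_EM_T; [contradiction | reflexivity]. Qed.

Lemma sinc_cont v : continuous sinc v.
Proof.
  destruct (Req_dec v 0) as [->|N].
  - intros P HP. rewrite sinc_0 in HP.
    pose proof (is_lim_sinc_0 P HP) as [d Hd]. exists d. intros y Hy.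
    destruct (Req_dec y 0) as [->|Ny].
    + rewrite sinc_0. apply locally_singleton; exact HP.
    + rewrite sinc_neq by exact Ny. apply Hd; assumption.
  - apply (continuous_ext_loc _ (fun t => sin t / t)).
    + generalize (open_neq 0 v N). apply filter_imp. intros t Ht; rewrite sinc_neq; auto.
    + apply Rcont_mult; [apply continuous_sin | apply continuous_Rinv; exact N].
Qed.

Lemma sinc_pos v : 0 <= v < PI -> 0 < sinc v.
Proof.
  intros [[H| <-] H2]; [|rewrite sinc_0; lra].
  rewrite sinc_neq by lra. apply Rdiv_lt_0_compat; [apply sin_gt_0|]; lra.
Qed.

(** 1 / weight, extended by continuity to v = 0 through [sinc] and by 0 at PI. *)
Definition inv_weight (v : R) : R :=
  if Rlt_dec v PI then sinc v * exp (cos v / sinc v) else 0.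

Lemma inv_weight_spec v : 0 < v < PI -> inv_weight v = / weight v.
Proof.
  intros Hv. assert (Hs : 0 < sin v) by (apply sin_gt_0; lra).
  unfold inv_weight. destruct Rlt_dec as [_|n]; [|lra].
  rewrite sinc_neq by lra. unfold weight, csc, cot.
  replace (- v * (cos v / sin v)) with (- (cos v / (sin v / v))) by (field; lra).
  rewrite exp_Ropp. pose proof (exp_pos (cos v / (sin v / v))). field. repeat split; lra.
Qed.

Lemma inv_weight_nonneg v : 0 <= v -> 0 <= inv_weight v.
Proof.
  intros Hv. unfold inv_weight. destruct Rlt_dec as [H|n]; [|lra].
  pose proof (sinc_pos v ltac:(lra)). pose proof (exp_pos (cos v / sinc v)).
  apply Rmult_le_pos; lra.
Qed.

(** Just before PI the exponential is at most 1, since cos v <= 0 there, so that the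
    function is squeezed by sin v. *)
Lemma inv_weight_cont v : 0 <= v <= PI -> continuous inv_weight v.
Proof.
  intros [H0 [H|H]].
  - apply (continuous_ext_loc _ (fun v => sinc v * exp (cos v / sinc v))).
    + generalize (open_lt PI v H). apply filter_imp. intros t Ht. unfold inv_weight.
      destruct Rlt_dec; [reflexivity | contradiction].
    + apply Rcont_mult; [apply sinc_cont|]. apply continuous_exp_comp.
      apply Rcont_mult; [apply continuous_cos|].
      apply Rcont_inv; [apply sinc_cont|]. pose proof (sinc_pos v (conj H0 H)); lra.
  - subst v.
    assert (E0 : inv_weight PI = 0) by (unfold inv_weight; destruct Rlt_dec; lra).
    intros P [e He]. rewrite E0 in He.
    pose proof (continuous_sin PI _ (locally_ball _ e)) as Hs. rewrite sin_PI in Hs.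
    assert (Hpi : PI / 2 < PI) by (pose proof PI_RGT_0; lra).
    unfold filtermap in Hs.
    pose proof (filter_and _ _ Hs (open_gt (PI / 2) PI Hpi)) as [d Hd].
    exists d. intros y Hy. apply He. destruct (Hd y Hy) as [H1 H2].
    change (Rabs (sin y - 0) < e) in H1. change (Rabs (inv_weight y - 0) < e).
    rewrite Rminus_0_r in *. unfold inv_weight. destruct Rlt_dec as [L|n];
      [|rewrite Rabs_R0; destruct e; auto].
    pose proof PI2_1 as P1.
    assert (Hsy : 0 < sin y) by (apply sin_gt_0; lra).
    eapply Rle_lt_trans; [|exact H1].
    pose proof (sinc_pos y ltac:(lra)) as Sp.
    assert (Sle : sinc y <= sin y).
    { rewrite sinc_neq by lra. apply Rle_div_l; [lra|]. nra. }
    assert (Ex : exp (cos y / sinc y) <= 1).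
    { rewrite <- exp_0. destruct (Rle_lt_or_eq_dec (cos y / sinc y) 0) as [L2|E2].
      - apply Rle_div_l; [exact Sp|]. rewrite Rmult_0_l. apply cos_le_0; lra.
      - left; apply exp_increasing; exact L2.
      - rewrite E2; lra. }
    pose proof (exp_pos (cos y / sinc y)).
    rewrite !Rabs_pos_eq; nra.
Qed.

Lemma edge_x_near_0 e : 0 < e -> exists d, 0 < d /\ forall v, 0 < v < d -> Rabs (edge_x v + 1) < e.
Proof.
  intros He.
  assert (c : continuous (fun v => - (cos v / sinc v)) 0).
  { apply Rcont_opp, Rcont_mult; [apply continuous_cos|].
    apply Rcont_inv; [apply sinc_cont | rewrite sinc_0; lra]. }
  destruct (c _ (locally_ball _ (mkposreal e He))) as [d Hd].
  assert (P : 0 < Rmin d PI) by (apply Rmin_pos; [destruct d; auto | apply PI_RGT_0]).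
  exists (Rmin d PI). split; [exact P|].
  intros v Hv.
  assert (Hv1 : v < d) by (eapply Rlt_le_trans; [apply Hv | apply Rmin_l]).
  assert (Hv2 : v < PI) by (eapply Rlt_le_trans; [apply Hv | apply Rmin_r]).
  assert (Hs : 0 < sin v) by (apply sin_gt_0; lra).
  assert (Hb : ball 0 d v).
  { change (Rabs (v - 0) < d). rewrite Rminus_0_r, Rabs_pos_eq; lra. }
  specialize (Hd v Hb). change (Rabs (- (cos v / sinc v) - - (cos 0 / sinc 0)) < e) in Hd.
  rewrite cos_0, sinc_0, sinc_neq in Hd by lra.
  replace (edge_x v + 1) with (- (cos v / (sin v / v)) - - (1 / 1)); [exact Hd|].
  unfold edge_x; field; lra.
Qed.

(** From 2 PI / 3 on, - v cos v >= 1, so that edge_x v >= 1 / sin v >= 1 / (PI - v). *)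
Lemma edge_x_near_PI M : exists d, 0 < d /\ forall v, PI - d < v < PI -> M < edge_x v.
Proof.
  pose proof PI_RGT_0 as P. pose proof PI2_1 as P1.
  set (K := Rmax 1 M + 1).
  assert (HK : 0 < K /\ M < K).
  { unfold K. pose proof (Rmax_l 1 M); pose proof (Rmax_r 1 M); lra. }
  assert (HKi : 0 < / K) by (apply Rinv_0_lt_compat; lra).
  exists (Rmin (PI / 3) (/ K)). split; [apply Rmin_pos; lra|].
  intros v Hv.
  pose proof (Rmin_l (PI / 3) (/ K)); pose proof (Rmin_r (PI / 3) (/ K)).
  assert (Hs : 0 < sin v) by (apply sin_gt_0; lra).
  assert (Hs2 : sin v < / K).
  { rewrite <- sin_PI_x. eapply Rlt_trans; [apply sin_lt_x; lra | lra]. }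
  assert (Hc : cos v <= - 1 / 2).
  { rewrite <- cos_2PI3. apply cos_decr_1; lra. }
  assert (Hv1 : 1 <= v) by lra.
  apply Rlt_le_trans with K; [lra|].
  unfold edge_x. apply Rle_div_r; [exact Hs|].
  assert (K * sin v <= 1).
  { apply Rlt_le. replace 1 with (K * / K) by (field; lra). apply Rmult_lt_compat_l; lra. }
  assert (2 <= v) by (pose proof PI_4; pose proof PI2_3_2; lra).
  nra.
Qed.

Lemma weight_nonneg v : 0 <= v <= PI -> 0 <= weight v.
Proof.
  intros [[H0| <-] H1]; [destruct H1 as [H1| ->]|].
  - left; apply weight_pos; lra.
  - unfold weight, csc. rewrite sin_PI, Rinv_0. right; ring.
  - unfold weight; right; ring.
Qed.

Lemma cut_plane_dist z : cut_plane 0 z ->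
  exists c, 0 < c /\ forall t, 0 <= t -> c <= Cmod (z + RtoC t)%C.
Proof.
  intros Hz. destruct (Req_dec (Im z) 0) as [E|N].
  - assert (Hr : 0 < Re z) by (apply Rnot_le_lt; intros K; apply Hz; auto).
    exists (Re z). split; [exact Hr|]. intros t Ht.
    eapply Rle_trans; [|apply re_le_Cmod]. change (Re (z + RtoC t)%C) with (Re z + t).
    rewrite Rabs_pos_eq; lra.
  - exists (Rabs (Im z)). split; [apply Rabs_pos_lt; exact N|]. intros t Ht.
    eapply Rle_trans; [|apply im_le_Cmod]. change (Im (z + RtoC t)%C) with (Im z + 0).
    rewrite Rplus_0_r; lra.
Qed.

Lemma cut_plane_add_neq0 z t : cut_plane 0 z -> 0 <= t -> (z + RtoC t)%C <> 0%C.
Proof.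
  intros Hz Ht E. destruct (cut_plane_dist z Hz) as (c & Hc & H). specialize (H t Ht).
  rewrite E, Cmod_0 in H. lra.
Qed.

Lemma dW_integrand_eq z v : dW_integrand z v = (/ (z + RtoC (weight v)))%C.
Proof. reflexivity. Qed.

(** 1 / (z + t) = s / (z s + 1) with s = 1 / t, and the right-hand side is continuous
    on [0, PI]. *)
Lemma dW_integrable z : cut_plane 0 z -> CIntable (dW_integrand z) 0 PI.
Proof.
  intros Hz. pose proof PI_RGT_0 as P.
  set (g := fun v => (RtoC (inv_weight v) / (z * RtoC (inv_weight v) + 1))%C).
  assert (Hg : CIntable g 0 PI).
  { apply CIntable_cont; [lra|]. intros v Hv.
    assert (c : Ccont (fun v => RtoC (inv_weight v)) v)
      by (apply Ccont_RtoC, inv_weight_cont; exact Hv).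
    apply Ccont_div; [exact c | |].
    - apply Ccont_plus; [|apply Ccont_const]. apply Ccont_mult; [apply Ccont_const | exact c].
    - pose proof (inv_weight_nonneg v (proj1 Hv)) as [Hp|H0].
      + assert (Hn : RtoC (inv_weight v) <> 0%C)
          by (intros E; apply (f_equal Re) in E; simpl in E; lra).
        replace (z * inv_weight v + 1)%C with (RtoC (inv_weight v) * (z + RtoC (/ inv_weight v)))%C.
        * apply Cmult_neq_0; [exact Hn|]. apply cut_plane_add_neq0; [exact Hz|].
          left; apply Rinv_0_lt_compat; exact Hp.
        * rewrite RtoC_inv by lra. field. exact Hn.
      + rewrite <- H0. intros E; apply (f_equal Re) in E. unfold Re in E; simpl in E. lra. }
  assert (Eg : forall v, 0 < v < PI -> g v = dW_integrand z v).
  { intros v Hv. rewrite dW_integrand_eq. unfold g.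
    pose proof (weight_pos v Hv) as Hw. rewrite inv_weight_spec, RtoC_inv by lra.
    assert (Hn : RtoC (weight v) <> 0%C) by (intros E; apply (f_equal Re) in E; simpl in E; lra).
    field. split; [|exact Hn]. apply cut_plane_add_neq0; [exact Hz | lra]. }
  destruct Hg as [H1 H2]; split.
  - apply (ex_RInt_ext (fun v => Re (g v))); [|exact H1].
    rewrite Rmin_left, Rmax_right by lra. intros v Hv; rewrite Eg; auto.
  - apply (ex_RInt_ext (fun v => Im (g v))); [|exact H2].
    rewrite Rmin_left, Rmax_right by lra. intros v Hv; rewrite Eg; auto.
Qed.

Lemma CIntable_sub f a b c d : CIntable f a b -> a <= c -> c <= d -> d <= b -> CIntable f c d.
Proof.
  intros [H1 H2] Hac Hcd Hdb.
  assert (K : forall g : R -> R, ex_RInt g a b -> ex_RInt g c d).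
  { intros g H. apply (ex_RInt_Chasles_1 (V := R_CompleteNormedModule) g c d b); [lra|].
    apply (ex_RInt_Chasles_2 (V := R_CompleteNormedModule) g a c b); [lra | exact H]. }
  split; apply K; assumption.
Qed.

Lemma CInt_Chasles f a b c : CIntable f a b -> CIntable f b c ->
  (CInt f a b + CInt f b c)%C = CInt f a c.
Proof.
  intros [H1 H2] [H3 H4].
  apply injective_projections;
    [exact (RInt_Chasles (V := R_CompleteNormedModule) _ a b c H1 H3)
    |exact (RInt_Chasles (V := R_CompleteNormedModule) _ a b c H2 H4)].
Qed.

(** The two edges combine into 2 i times the integral of the theorem: E has the same
    value at conjugate points of the curve and the differentials differ by -2 i dv. *)
Lemma contour_identity w e V : Omega w -> cut_plane 0 (zexp w) -> zexp' w <> 0%C ->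
  0 < e -> e < V -> V < PI ->
  - V < Im w < V -> Re w < edge_x V -> (- e <= Im w <= e -> edge_x e < Re w) ->
  (2 * Ci * CInt (dW_integrand (zexp w)) e V
   + cauchy_int w (vert (edge_x V)) (fun _ => Ci) (- V)%R V
   - cauchy_int w (vert (edge_x e)) (fun _ => Ci) (- e)%R e)%C
  = (RtoC (2 * PI) * Ci / zexp' w)%C.
Proof.
  intros Hw Hz Hw' He HeV HV Hi Hr Hl.
  assert (ne : forall v, 0 < v < PI -> forall u, zexp u = RtoC (- weight v) -> u <> w).
  { intros v Hv u Eu ->. apply Hz. rewrite Eu. pose proof (weight_pos v Hv).
    split; [reflexivity | simpl; lra]. }
  assert (P1 : admissible_arc w edge_conj edge_conj' e V).
  { intros v Hv. assert (Hv' : 0 < v < PI) by lra.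
    split; [apply Omega_conj, Omega_edge; exact Hv'|]. split.
    - apply (ne v Hv'). unfold edge_conj. rewrite zexp_conj, zexp_edge by exact Hv'.
      apply injective_projections; simpl; ring.
    - split; [apply Cder_conj, edge_der; exact Hv' | apply Ccont_conj, edge'_cont; exact Hv']. }
  assert (P3 : admissible_arc w edge edge' e V).
  { intros v Hv. assert (Hv' : 0 < v < PI) by lra.
    split; [apply Omega_edge; exact Hv'|]. split.
    - apply (ne v Hv'), zexp_edge; exact Hv'.
    - split; [apply edge_der; exact Hv' | apply edge'_cont; exact Hv']. }
  assert (P2 : admissible_arc w (vert (edge_x V)) (fun _ => Ci) (- V) V).
  { intros v Hv. split; [apply Omega_vert; lra|]. split.
    - intros E. rewrite <- E in Hr. simpl in Hr. lra.
    - split; [apply vert_der | apply Ccont_const]. }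
  assert (P4 : admissible_arc w (vert (edge_x e)) (fun _ => Ci) (- e) e).
  { intros v Hv. split; [apply Omega_vert; lra|]. split.
    - intros E. rewrite <- E in Hl. specialize (Hl Hv). simpl in Hl. lra.
    - split; [apply vert_der | apply Ccont_const]. }
  pose proof (contour_deform w e V Hw Hz Hw' He HeV P1 P2 P3 P4) as D.
  rewrite (contour_winding w e V) in D by assumption.
  assert (Int : forall p dp, admissible_arc w p dp e V ->
     CIntable (fun v => dp v / (zexp (p v) - zexp w))%C e V).
  { intros p dp P. apply CIntable_cont; [lra|]. intros v Hv.
    destruct (P v Hv) as (H1 & H2 & H3 & H4). apply Ccont_div; [exact H4| |].
    - apply Ccont_minus; [|apply Ccont_const].
      exact (Cder_cont _ _ _ (Cder_zexp _ _ _ H3)).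
    - apply Cminus_eq_contra. intros E; apply H2, zexp_inj_Omega; assumption. }
  assert (M : (cauchy_int w edge_conj edge_conj' e V - cauchy_int w edge edge' e V
     = 2 * Ci * CInt (dW_integrand (zexp w)) e V)%C).
  { unfold cauchy_int. rewrite <- CInt_minus by (apply Int; assumption).
    rewrite <- CInt_scal.
    - apply CInt_ext; [lra|]. intros v Hv. assert (Hv' : 0 < v < PI) by lra.
      unfold edge_conj. rewrite zexp_conj, zexp_edge by exact Hv'.
      replace (Cconj (RtoC (- weight v))) with (- RtoC (weight v))%C
        by (apply injective_projections; simpl; ring).
      rewrite RtoC_opp, dW_integrand_eq.
      assert (Eg : (edge_conj' v = edge' v - 2 * Ci)%C)
        by (apply injective_projections; simpl; ring).
      rewrite Eg. generalize (edge' v); intros k.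
      pose proof (weight_pos v Hv') as Hp.
      pose proof (cut_plane_add_neq0 (zexp w) (weight v) Hz (Rlt_le _ _ Hp)) as N.
      assert (N' : (- RtoC (weight v) - zexp w)%C <> 0%C).
      { intros E. apply N. replace (zexp w + weight v)%C with (- (- weight v - zexp w))%C by ring.
        rewrite E. ring. }
      replace (/ (zexp w + weight v))%C with (- / (- weight v - zexp w))%C by (field; auto).
      field. exact N'.
    - apply (CIntable_sub _ 0 PI); try lra. apply dW_integrable; exact Hz. }
  unfold contour_sum in D.
  transitivity (/ zexp' w * (RtoC (2 * PI) * Ci))%C; [|field; exact Hw'].
  rewrite <- D, <- M. ring.
Qed.

Lemma right_edge_bound z X y : Cmod z < X -> Cmod (zexp (vert X y) - z)%C >= X - Cmod z.
Proof.
  intros HX. pose proof (Cmod_ge_0 z) as Pz.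
  assert (K : X <= Cmod (zexp (vert X y))).
  { unfold zexp. rewrite Cmod_mult.
    assert (E : Cmod (Cexp (vert X y)) = exp X).
    { unfold Cmod, Cexp, vert; simpl.
      replace (_ + _) with (exp X * exp X * ((sin y)² + (cos y)²)) by (unfold Rsqr; ring).
      rewrite sin2_cos2, Rmult_1_r. apply sqrt_square. left; apply exp_pos. }
    rewrite E. pose proof (re_le_Cmod (vert X y)) as R. simpl in R.
    rewrite Rabs_pos_eq in R by lra. pose proof (exp_ineq1_le X). nra. }
  pose proof (Cmod_triangle (zexp (vert X y) - z) z) as T.
  replace (zexp (vert X y) - z + z)%C with (zexp (vert X y)) in T by ring. lra.
Qed.

(** The left segment shrinks to the point -1, where E = -1/e lies on the cut and so
    differs from z. *)
Lemma left_edge_bound z : cut_plane 0 z -> exists c d, 0 < c /\ 0 < d /\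
  forall x y, Rabs (x + 1) < d -> Rabs y < d -> c <= Cmod (zexp (vert x y) - z)%C.
Proof.
  intros Hz.
  set (m := vert (-1) 0).
  assert (N : (zexp m - z)%C <> 0%C).
  { apply Cminus_eq_contra. intros E. apply Hz. rewrite <- E, Im_zexp, Re_zexp. simpl.
    rewrite sin_0, cos_0. pose proof (exp_pos (-1)). lra. }
  apply Cmod_gt_0 in N.
  assert (N2 : 0 < Cmod (zexp m - z) / 2) by lra.
  destruct (Ccont_near _ _ (zexp_cont m) (mkposreal _ N2)) as [d Hd]. simpl in Hd.
  exists (Cmod (zexp m - z) / 2), d. split; [exact N2|]. split; [destruct d; auto|].
  intros x y Hx Hy.
  assert (Hb : ball (M := C_UniformSpace) m d (vert x y)).
  { split; [change (Rabs (x - -1) < d) | change (Rabs (y - 0) < d)].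
    - replace (x - -1) with (x + 1) by ring; exact Hx.
    - rewrite Rminus_0_r; exact Hy. }
  specialize (Hd (vert x y) Hb).
  pose proof (Cmod_triangle (zexp m - zexp (vert x y)) (zexp (vert x y) - z)) as T.
  replace (zexp m - zexp (vert x y) + (zexp (vert x y) - z))%C with (zexp m - z)%C in T by ring.
  replace (zexp m - zexp (vert x y))%C with (- (zexp (vert x y) - zexp m))%C in T by ring.
  rewrite Cmod_opp in T. lra.
Qed.

Lemma cauchy_int_vert_bound w x a c : 0 <= a -> 0 < c ->
  (forall y, - a <= y <= a -> c <= Cmod (zexp (vert x y) - zexp w)%C) ->
  Cmod (cauchy_int w (vert x) (fun _ => Ci) (- a) a) <= 4 * a * / c.
Proof.
  intros Ha Hc H.
  assert (nz : forall y, - a <= y <= a -> (zexp (vert x y) - zexp w)%C <> 0%C).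
  { intros y Hy. apply Cmod_gt_0. specialize (H y Hy); lra. }
  replace (4 * a * / c) with (2 * ((a - - a) * / c)) by ring.
  apply CInt_bound; [lra | |].
  - apply CIntable_cont; [lra|]. intros y Hy. apply Ccont_div; [apply Ccont_const| |apply nz; exact Hy].
    apply Ccont_minus; [|apply Ccont_const].
    exact (Cder_cont _ _ _ (Cder_zexp _ _ _ (vert_der x y))).
  - intros y Hy. rewrite Cmod_div, Cmod_Ci by (apply nz; exact Hy).
    unfold Rdiv; rewrite Rmult_1_l. apply Rinv_le_contravar; [exact Hc | apply H; exact Hy].
Qed.

(** Let e tend to 0 and V to PI in [contour_identity].  The defect D does not depend
    on e and V, and is bounded by a constant times an arbitrary h > 0. *)
Lemma integral_value w : Omega w -> cut_plane 0 (zexp w) -> zexp' w <> 0%C ->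
  CInt (dW_integrand (zexp w)) 0 PI = (RtoC PI / zexp' w)%C.
Proof.
  intros Hw Hz Hw'. set (z := zexp w) in *. pose proof PI_RGT_0 as HPI.
  set (D := (2 * Ci * CInt (dW_integrand z) 0 PI - RtoC (2 * PI) * Ci / zexp' w)%C).
  destruct (cut_plane_dist z Hz) as (c & Hc & Hcd).
  destruct (left_edge_bound z Hz) as (c1 & d1 & Hc1 & Hd1 & Hl1).
  destruct (edge_x_near_0 (Rmin d1 1) (Rmin_pos _ _ Hd1 Rlt_0_1)) as (d2 & Hd2 & Hb0).
  assert (Hwl : exists d3, 0 < d3 /\ forall e, 0 < e < d3 -> (- e <= Im w <= e -> edge_x e < Re w)).
  { destruct (Req_dec (Im w) 0) as [E|N].
    - exists d2. split; [exact Hd2|]. intros e He _.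
      assert (Ez : Im z = 0) by (unfold z; rewrite Im_zexp, E, sin_0; ring).
      assert (Hr : 0 < Re z) by (apply Rnot_le_lt; intros K; apply Hz; auto).
      destruct (zexp_real w) as [_ K]; [apply Hw | exact Ez | exact Hr |].
      specialize (Hb0 e He). pose proof (Rmin_r d1 1).
      apply Rabs_lt_between in Hb0. lra.
    - exists (Rabs (Im w)). split; [apply Rabs_pos_lt; exact N|].
      intros e He K. apply Rabs_le in K. lra. }
  destruct Hwl as (d3 & Hd3 & Hwl).
  assert (Hwi : 0 < PI - Rabs (Im w)).
  { destruct Hw as ((K1 & K2) & _). assert (Rabs (Im w) < PI) by (apply Rabs_def1; lra). lra. }
  assert (Main : forall h, 0 < h -> Cmod D <= (8 / c + 4 * PI + 4 / c1) * h).
  { intros h Hh.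
    destruct (edge_x_near_PI (Cmod z + / h + Rabs (Re w))) as (d4 & Hd4 & HbP).
    assert (Hhi : 0 < / h) by (apply Rinv_0_lt_compat; exact Hh).
    assert (He : exists e, 0 < e /\ e < h /\ e < d1 /\ e < d2 /\ e < d3 /\ e < PI / 2).
    { exists (Rmin (Rmin (Rmin h d1) (Rmin d2 d3)) (PI / 2) / 2).
      set (a := Rmin (Rmin (Rmin h d1) (Rmin d2 d3)) (PI / 2)).
      assert (0 < a) by (unfold a; repeat apply Rmin_pos; lra).
      assert (a <= h /\ a <= d1 /\ a <= d2 /\ a <= d3 /\ a <= PI / 2).
      { unfold a; unfold Rmin; repeat destruct Rle_dec; repeat split; lra. }
      repeat split; lra. }
    destruct He as (e & He0 & Heh & He1 & He2 & He3 & He4).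
    assert (HV : exists V, V < PI /\ PI - V < h /\ PI - V < d4 /\ PI - V < PI / 2 /\
      PI - V < PI - Rabs (Im w)).
    { set (a := Rmin (Rmin h d4) (Rmin (PI / 2) (PI - Rabs (Im w)))).
      assert (0 < a) by (unfold a; repeat apply Rmin_pos; lra).
      assert (a <= h /\ a <= d4 /\ a <= PI / 2 /\ a <= PI - Rabs (Im w)).
      { unfold a; unfold Rmin; repeat destruct Rle_dec; repeat split; lra. }
      exists (PI - a / 2). repeat split; lra. }
    destruct HV as (V & HV0 & HVh & HV4 & HV2 & HVi).
    specialize (HbP V ltac:(lra)).
    assert (Hi : - V < Im w < V) by (apply Rabs_lt_between; lra).
    assert (Hr : Re w < edge_x V).
    { pose proof (Rle_abs (Re w)). pose proof (Cmod_ge_0 z). lra. }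
    pose proof (contour_identity w e V Hw Hz Hw' He0 ltac:(lra) HV0 Hi Hr (Hwl e ltac:(lra))) as Id.
    fold z in Id.
    set (Rt := cauchy_int w (vert (edge_x V)) (fun _ => Ci) (- V) V) in *.
    set (Lf := cauchy_int w (vert (edge_x e)) (fun _ => Ci) (- e) e) in *.
    assert (BR : Cmod Rt <= 4 * V * / / h).
    { apply cauchy_int_vert_bound; [lra | exact Hhi |]. intros y Hy. fold z.
      pose proof (Rabs_pos (Re w)).
      pose proof (right_edge_bound z (edge_x V) y ltac:(lra)). lra. }
    rewrite Rinv_inv in BR.
    assert (BL : Cmod Lf <= 4 * e * / c1).
    { apply cauchy_int_vert_bound; [lra | exact Hc1 |]. intros y Hy. fold z.
      apply Hl1.
      - eapply Rlt_le_trans; [apply Hb0; lra | apply Rmin_l].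
      - apply Rle_lt_trans with e; [apply Rabs_le; lra | lra]. }
    pose proof (dW_integrable z Hz) as HI.
    assert (B : forall a b, 0 <= a -> a <= b -> b <= PI ->
       Cmod (CInt (dW_integrand z) a b) <= 2 * ((b - a) * / c)).
    { intros a b Ha Hab Hb. apply CInt_bound; [exact Hab | |].
      - apply (CIntable_sub _ 0 PI); assumption.
      - intros t Ht. rewrite dW_integrand_eq.
        pose proof (weight_nonneg t ltac:(lra)) as Wt.
        rewrite Cmod_inv by (apply cut_plane_add_neq0; assumption).
        apply Rinv_le_contravar; [exact Hc | apply Hcd; exact Wt]. }
    pose proof (B 0 e ltac:(lra) ltac:(lra) ltac:(lra)) as B1.
    pose proof (B V PI ltac:(lra) ltac:(lra) ltac:(lra)) as B2.
    assert (Ch : (CInt (dW_integrand z) 0 PI = CInt (dW_integrand z) 0 e +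
       (CInt (dW_integrand z) e V + CInt (dW_integrand z) V PI))%C).
    { rewrite !CInt_Chasles; [reflexivity| | | |];
        apply (CIntable_sub _ 0 PI); try assumption; lra. }
    assert (ED : (D = 2 * Ci * CInt (dW_integrand z) 0 e + 2 * Ci * CInt (dW_integrand z) V PI
       + (Lf - Rt))%C).
    { unfold D. rewrite <- Id, Ch. ring. }
    rewrite ED.
    assert (C2 : Cmod (2 * Ci) = 2).
    { rewrite Cmod_mult, Cmod_Ci, Cmod_R, Rabs_pos_eq; lra. }
    eapply Rle_trans; [apply Cmod_triangle|].
    eapply Rle_trans; [apply Rplus_le_compat_r, Cmod_triangle|].
    rewrite !(Cmod_mult (2 * Ci)), C2.
    pose proof (Cmod_triangle Lf (- Rt)) as T. rewrite Cmod_opp in T.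
    change (Lf + - Rt)%C with (Lf - Rt)%C in T.
    assert (Hci : 0 < / c) by (apply Rinv_0_lt_compat; exact Hc).
    assert (Hc1i : 0 < / c1) by (apply Rinv_0_lt_compat; exact Hc1).
    assert (U1 : (e - 0) * / c <= h * / c) by (apply Rmult_le_compat_r; lra).
    assert (U2 : (PI - V) * / c <= h * / c) by (apply Rmult_le_compat_r; lra).
    assert (U3 : e * / c1 <= h * / c1) by (apply Rmult_le_compat_r; lra).
    assert (U4 : V * h <= PI * h) by (apply Rmult_le_compat_r; lra).
    unfold Rdiv. lra. }
  assert (D0 : D = 0%C).
  { apply Cmod_eq_0. pose proof (Cmod_ge_0 D) as P0.
    set (A := 8 / c + 4 * PI + 4 / c1) in *.
    assert (HA : 0 < A).
    { unfold A. assert (0 < 8 / c) by (apply Rdiv_lt_0_compat; lra).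
      assert (0 < 4 / c1) by (apply Rdiv_lt_0_compat; lra). lra. }
    destruct P0 as [P0|P0]; [|auto].
    specialize (Main (Cmod D / (2 * A)) ltac:(apply Rdiv_lt_0_compat; lra)).
    replace (A * (Cmod D / (2 * A))) with (Cmod D / 2) in Main by (field; lra). lra. }
  assert (N2 : RtoC 2 <> 0%C) by (intros E; apply (f_equal Re) in E; simpl in E; lra).
  unfold D in D0. apply Ceq_minus in D0.
  transitivity ((2 * Ci * CInt (dW_integrand z) 0 PI) / (2 * Ci))%C.
  - field. repeat split; first [exact Ci_nz | exact N2].
  - rewrite D0, RtoC_mult. field. repeat split; first [exact Ci_nz | exact N2 | exact Hw'].
Qed.

Theorem theorem3p3 (W : C -> C) (hW : is_LambertW W)
    (z : C) (hz0 : z <> RtoC 0) (hz : cut_plane 0 z) :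
  @ex_RInt C_R_NormedModule (dW_integrand z) 0 PI /\
  C_derive W z
    = (RtoC (1 / PI) * @RInt C_R_CompleteNormedModule (dW_integrand z) 0 PI)%C.
Proof.
  pose proof PI_RGT_0 as HPI.
  pose proof (cut_plane_0_inv_e z hz) as hz'.
  pose proof (Lambert_zexp W z hW hz') as Ez.
  pose proof (Lambert_derive W z hW hz') as Ed.
  assert (Hw' : zexp' (W z) <> 0%C).
  { intros E. rewrite E, Cmult_0_l in Ed. apply (f_equal Re) in Ed. simpl in Ed. lra. }
  destruct (dW_integrable z hz) as [H1 H2].
  assert (HI : @is_RInt C_R_NormedModule (dW_integrand z) 0 PI (CInt (dW_integrand z) 0 PI)).
  { apply (is_RInt_fct_extend_pair (U := R_NormedModule) (V := R_NormedModule));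
      apply (RInt_correct (V := R_CompleteNormedModule)); assumption. }
  split; [eexists; exact HI|].
  rewrite (is_RInt_unique (V := C_R_CompleteNormedModule) _ _ _ _ HI).
  pose proof (integral_value (W z) (Lambert_Omega W z hW hz)) as J. rewrite Ez in J.
  rewrite J by assumption.
  assert (NP : RtoC PI <> 0%C) by (intros E; apply (f_equal Re) in E; simpl in E; lra).
  rewrite RtoC_div by lra.
  transitivity (/ zexp' (W z))%C.
  - rewrite <- (Cmult_1_r (/ zexp' (W z))), <- Ed. field. exact Hw'.
  - field. split; assumption.
Qed.
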